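(* Let $t$ be a $\lambda$-term such that $;\vdash t:\mathbf{W}_{\mathrm{Church}}\Rightarrow\mathbf{W}_{\mathrm{Scott}}$ is derivable in $\mathrm{DIAL}$. Then the function $f_t:\{0,1\}^*\to\{0,1\}^*$ defined by $f_t(w_1)=w_2$ iff the $\beta$-normal form of $t\,\underline{w_1}$ equals $\overline{w_2}$ is (well defined and) computable in polynomial time.
   Context: $\lambda$-terms: $t::=x\mid\lambda x.t\mid tu$. The system $\mathrm{DIAL}$: linear formulas $L,M::=\alpha\mid\forall\alpha L\mid\mu\alpha L\mid L\multimap M$ (where $\mu\alpha L$ may be formed only if $\alpha$ occurs only positively in $L$); formulas $A,B::=L\mid\forall\alpha A\mid L\multimap B\mid A\Rightarrow B$. Judgments $\Gamma;\Delta\vdash t:A$ where $\Delta$ assigns linear formulas and $\Gamma$ arbitrary formulas to distinct variables. Rules: (ax1) $x:A;\vdash x:A$; (ax2) $;x:L\vdash x:L$; ($\mu_e$) from $\Gamma;\Delta\vdash t:\mu\alpha L$ infer $\Gamma;\Delta\vdash t:L[\mu\alpha L/\alpha]$; ($\mu_i$) the converse; ($\forall_i$) from $\Gamma;\Delta\vdash t:A$ with $\alpha$ not free in $\Gamma,\Delta$ infer $\Gamma;\Delta\vdash t:\forall\alpha A$; ($\forall_e$) from $\Gamma;\Delta\vdash t:\forall\alpha A$ infer $\Gamma;\Delta\vdash t:A[L/\alpha]$ for $L$ linear; ($\Rightarrow_e$) from $\Gamma_1;\Delta\vdash t:A\Rightarrow B$ and $\Gamma_2;\vdash u:A$ infer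 $\Gamma_1,\Gamma_2;\Delta\vdash tu:B$; ($\Rightarrow_i$) from $\Gamma,z:A;\Delta\vdash t:B$ infer $\Gamma;\Delta\vdash\lambda z.t:A\Rightarrow B$; ($\multimap_e$) from $\Gamma_1;\Delta_1\vdash t:L\multimap B$ and $\Gamma_2;\Delta_2\vdash u:L$ infer $\Gamma_1,\Gamma_2;\Delta_1,\Delta_2\vdash tu:B$; ($\multimap_i$) from $\Gamma;\Delta,z:L\vdash t:B$ infer $\Gamma;\Delta\vdash\lambda z.t:L\multimap B$; (Contr) from $\Gamma,x:A,y:A;\Delta\vdash t:B$ infer $\Gamma,z:A;\Delta\vdash t[z/x,z/y]:B$; (Derel) from $\Gamma;\Delta,x:L\vdash t:B$ infer $\Gamma,x:L;\Delta\vdash t:B$; (Weak) from $\Gamma;\Delta\vdash t:B$ infer $\Gamma,\Gamma';\Delta,\Delta'\vdash t:B$. $\mathbf{W}_{\mathrm{Church}}=\forall\alpha(\alpha\multimap\alpha)\Rightarrow(\alpha\multimap\alpha)\Rightarrow(\alpha\multimap\alpha)$, $\underline{w}=\lambda f_0f_1x.f_{i_1}(f_{i_2}(\cdots f_{i_n}(x)\cdots))$ for $w=i_1\cdots i_n$; $\mathbf{W}_{\mathrm{Scott}}=\mu\beta\forall\alpha(\beta\multimap\alpha)\multimap(\beta\multimap\alpha)\multimap(\alpha\multimap\alpha)$, $\overline{\epsilon}=\lambda xyz.z$, $\overline{0w}=\lambda xyz.x\,\overline{w}$, $\overline{1w}=\lambda xyz.y\,\overline{w}$. *)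

(* Defs.v *)
(* MathComp world. *)
From Stdlib Require Import Relations Permutation.
From mathcomp Require Import all_boot all_algebra.

Set Implicit Arguments.
Unset Strict Implicit.
Unset Printing Implicit Defensive.

(* Lambda-terms up to alpha-equivalence, in de Bruijn notation. Free variables
   are named by natural numbers: under d binders, index d + x denotes the free
   variable x. *)
Inductive term : Type :=
| Var of nat
| Lam of term
| App of term & term.

(* Variable renamings and substitutions under one more binder. *)
Definition upr (r : nat -> nat) (n : nat) : nat :=
  if n is m.+1 then (r m).+1 else 0.

Fixpoint rename (r : nat -> nat) (t : term) : term :=
  match t with
  | Var n => Var (r n)
  | Lam u => Lam (rename (upr r) u)
  | App u v => App (rename r u) (rename r v)
  end.

Definition ups (s : nat -> term) (n : nat) : term :=
  if n is m.+1 then rename S (s m) else Var 0.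

Fixpoint subst (s : nat -> term) (t : term) : term :=
  match t with
  | Var n => s n
  | Lam u => Lam (subst (ups s) u)
  | App u v => App (subst s u) (subst s v)
  end.

(* Contractum of (\x. t) u, where t is the body (x is index 0). *)
Definition inst (t u : term) : term :=
  subst (fun n => if n is m.+1 then Var m else u) t.

(* The term \z. t, binding the named free variable z of t. *)
Definition lam (z : nat) (t : term) : term :=
  Lam (rename (fun n => if n == z then 0 else n.+1) t).

Inductive beta : term -> term -> Prop :=
| beta_red t u : beta (App (Lam t) u) (inst t u)
| beta_lam t t' : beta t t' -> beta (Lam t) (Lam t')
| beta_appl t t' u : beta t t' -> beta (App t u) (App t' u)
| beta_appr t u u' : beta u u' -> beta (App t u) (App t u').

Definition normal (t : term) : Prop := forall u, ~ beta t u.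

Definition beta_normal_form (t u : term) : Prop :=
  clos_refl_trans term beta t u /\ normal u.

(* Formulas are carved out of the raw syntax [form] by [is_linear] and [is_formula];
   type variables are de Bruijn indices bound by [All] and [Mu]. *)
Inductive form : Type :=
| TVar of nat
| All of form
| Mu of form
| Lolli of form & form
| Arr of form & form.

Fixpoint frename (r : nat -> nat) (A : form) : form :=
  match A with
  | TVar n => TVar (r n)
  | All B => All (frename (upr r) B)
  | Mu B => Mu (frename (upr r) B)
  | Lolli B C => Lolli (frename r B) (frename r C)
  | Arr B C => Arr (frename r B) (frename r C)
  end.

Definition fups (s : nat -> form) (n : nat) : form :=
  if n is m.+1 then frename S (s m) else TVar 0.

Fixpoint fsubst (s : nat -> form) (A : form) : form :=
  match A with
  | TVar n => s n
  | All B => All (fsubst (fups s) B)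
  | Mu B => Mu (fsubst (fups s) B)
  | Lolli B C => Lolli (fsubst s B) (fsubst s C)
  | Arr B C => Arr (fsubst s B) (fsubst s C)
  end.

(* A[L/alpha], where alpha is index 0 of A. *)
Definition finst (A L : form) : form :=
  fsubst (fun n => if n is m.+1 then TVar m else L) A.

(* All free occurrences of the type variable k in A are positive (b = true),
   resp. negative (b = false). *)
Fixpoint occurs_only (b : bool) (k : nat) (A : form) : bool :=
  match A with
  | TVar n => b || (n != k)
  | All B => occurs_only b k.+1 B
  | Mu B => occurs_only b k.+1 B
  | Lolli B C => occurs_only (~~ b) k B && occurs_only b k C
  | Arr B C => occurs_only (~~ b) k B && occurs_only b k C
  end.

Fixpoint is_linear (A : form) : bool :=
  match A with
  | TVar _ => true
  | All L => is_linear L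
  | Mu L => is_linear L && occurs_only true 0 L
  | Lolli L M => is_linear L && is_linear M
  | Arr _ _ => false
  end.

Fixpoint is_formula (A : form) : bool :=
  is_linear A ||
  match A with
  | All B => is_formula B
  | Lolli L B => is_linear L && is_formula B
  | Arr B C => is_formula B && is_formula C
  | _ => false
  end.

(* Contexts are finite sets of declarations, here lists subject to an explicit
   exchange rule. *)
Definition ctx := seq (nat * form).

Definition dom (G : ctx) : seq nat := [seq d.1 | d <- G].

Definition distinct (G D : ctx) : bool := uniq (dom G ++ dom D).

(* Weakening by the type variable 0: a context in the image of [cshift] is one
   in which the type variable 0 is not free. *)
Definition cshift (G : ctx) : ctx := [seq (d.1, frename S d.2) | d <- G].

(* [dial G D t A] is the judgment G; D |- t : A. *)
Inductive dial : ctx -> ctx -> term -> form -> Prop :=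
| dial_ax1 x A :
    is_formula A ->
    dial [:: (x, A)] [::] (Var x) A
| dial_ax2 x L :
    is_linear L ->
    dial [::] [:: (x, L)] (Var x) L
| dial_mu_e G D t L :
    dial G D t (Mu L) ->
    dial G D t (finst L (Mu L))
| dial_mu_i G D t L :
    is_linear (Mu L) ->
    dial G D t (finst L (Mu L)) ->
    dial G D t (Mu L)
| dial_all_i G D t A :
    dial (cshift G) (cshift D) t A ->
    dial G D t (All A)
| dial_all_e G D t A L :
    is_linear L ->
    dial G D t (All A) ->
    dial G D t (finst A L)
| dial_arr_e G1 G2 D t u A B :
    distinct (G1 ++ G2) D ->
    dial G1 D t (Arr A B) ->
    dial G2 [::] u A ->
    dial (G1 ++ G2) D (App t u) B
| dial_arr_i G D z A t B :
    dial ((z, A) :: G) D t B ->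
    dial G D (lam z t) (Arr A B)
| dial_lolli_e G1 G2 D1 D2 t u L B :
    distinct (G1 ++ G2) (D1 ++ D2) ->
    dial G1 D1 t (Lolli L B) ->
    dial G2 D2 u L ->
    dial (G1 ++ G2) (D1 ++ D2) (App t u) B
| dial_lolli_i G D z L t B :
    dial G ((z, L) :: D) t B ->
    dial G D (lam z t) (Lolli L B)
| dial_contr G D x y z A t B :
    distinct ((z, A) :: G) D ->
    dial ((x, A) :: (y, A) :: G) D t B ->
    dial ((z, A) :: G) D
         (rename (fun n => if (n == x) || (n == y) then z else n) t) B
| dial_derel G D x L t B :
    dial G ((x, L) :: D) t B ->
    dial ((x, L) :: G) D t B
| dial_weak G G' D D' t B :
    distinct (G ++ G') (D ++ D') ->
    all (fun d => is_formula d.2) G' ->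
    all (fun d => is_linear d.2) D' ->
    dial G D t B ->
    dial (G ++ G') (D ++ D') t B
| dial_exch G G' D D' t B :
    Permutation G G' ->
    Permutation D D' ->
    dial G D t B ->
    dial G' D' t B.

(* Binary words are bit lists; false is the letter 0 and true the letter 1. *)
Definition word := seq bool.

Definition WChurch : form :=
  All (Arr (Lolli (TVar 0) (TVar 0))
      (Arr (Lolli (TVar 0) (TVar 0))
           (Lolli (TVar 0) (TVar 0)))).

(* Under the two binders, alpha is index 0 and beta is index 1. *)
Definition WScott : form :=
  Mu (All (Lolli (Lolli (TVar 1) (TVar 0))
          (Lolli (Lolli (TVar 1) (TVar 0))
                 (Lolli (TVar 0) (TVar 0))))).

(* In \f0 f1 x. _ (and \x y z. _), the bound variables are 2, 1 and 0. *)
Definition letter (b : bool) : term := Var (if b then 1 else 2).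

Definition church (w : word) : term :=
  Lam (Lam (Lam (foldr (fun b u => App (letter b) u) (Var 0) w))).

(* [scott w] is closed, so no shifting is needed below the binders. *)
Fixpoint scott (w : word) : term :=
  match w with
  | [::] => Lam (Lam (Lam (Var 0)))
  | b :: w' => Lam (Lam (Lam (App (letter b) (scott w'))))
  end.

(* Deterministic Turing machines with ntapes.+1 two-way infinite tapes over
   the alphabet made of the blank (None), the bits (Some (inl b)) and finitely
   many auxiliary symbols (Some (inr a)). *)
Inductive direction := MoveL | MoveN | MoveR.

Record TM : Type := {
  ntapes : nat;
  state : finType;
  aux : finType;
  start : state;
  halting : pred state;
  delta : state -> {ffun 'I_ntapes.+1 -> option (bool + aux)} ->
          state * {ffun 'I_ntapes.+1 -> option (bool + aux) * direction}
}.

Definition symbol (M : TM) : Type := option (bool + aux M).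

(* Cells left of the head (nearest first), scanned cell, cells right of the
   head; all the remaining cells are blank. *)
Record tape (M : TM) : Type := Tape {
  lcells : seq (symbol M);
  scanned : symbol M;
  rcells : seq (symbol M)
}.

Definition write (M : TM) (a : symbol M) (tp : tape M) : tape M :=
  Tape (lcells tp) a (rcells tp).

Definition move (M : TM) (d : direction) (tp : tape M) : tape M :=
  let: Tape l a r := tp in
  match d with
  | MoveL => Tape (behead l) (head None l) (a :: r)
  | MoveN => tp
  | MoveR => Tape (a :: l) (head None r) (behead r)
  end.

Record config (M : TM) : Type := Config {
  cstate : state M;
  ctapes : 'I_(ntapes M).+1 -> tape M
}.

Definition tm_step (M : TM) (c : config M) : config M :=
  if halting (cstate c) then c else
  let: (q, act) := delta (cstate c) [ffun i => scanned (ctapes c i)] in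
  Config q (fun i => move (act i).2 (write (act i).1 (ctapes c i))).

(* The input word is on tape 0 with the head on its first letter; the other
   tapes are blank. *)
Definition tape_of_word (M : TM) (w : word) : tape M :=
  let s : seq (symbol M) := [seq Some (inl b) | b <- w] in
  Tape [::] (head None s) (behead s).

Definition tm_init (M : TM) (w : word) : config M :=
  Config (start M)
    (fun i => if i == ord0 then tape_of_word M w else Tape [::] None [::]).

(* The output is the longest block of bits starting at the head of the last
   tape. *)
Fixpoint leading_bits (M : TM) (s : seq (symbol M)) : word :=
  if s is Some (inl b) :: s' then b :: leading_bits s' else [::].

Definition tm_output (M : TM) (c : config M) : word :=
  let tp := ctapes c ord_max in leading_bits (scanned tp :: rcells tp).

Definition polytime (f : word -> word) : Prop :=
  exists (M : TM) (p : {poly nat}), forall w : word,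
  exists2 m : nat, m <= p.[size w]%R &
    let c := iter m (@tm_step M) (tm_init M w) in
    halting (cstate c) /\ tm_output c = f w.

(* Main.v *)
(* Realizability with explicit costs. The closures and states of a Krivine machine
   realize formulas: linear formulas are interpreted by sets of pairs (state, number
   of steps), a linear argument adds its cost to the cost of the result, and a
   realizer of A => B comes with a functional transforming cost functionals of A
   into cost functionals of B. The ground costs are polynomials in the length n of
   the input; the Church word of length n realizes its type with the functional
   a, b |-> n(a + b + 4) + 4, so applying the functional of the closed term t to it
   yields a polynomial. Since mu is interpreted by the least fixpoint, a realizer of
   W_Scott applied to three fresh constants hands back, bit by bit, within a
   polynomial number of transitions, a word whose Scott encoding is its normal form.
   A Turing machine runs the Krivine machine with closures and stacks stored in an
   append-only memory addressed by unary pointers, so that each transition costs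
   polynomially many steps. *)

Require Import Defs.
From Stdlib Require Import Relations Permutation FunctionalExtensionality
  IndefiniteDescription.
From mathcomp Require Import all_boot ssralg poly zify.

Set Implicit Arguments.
Unset Strict Implicit.
Unset Printing Implicit Defensive.

(** * Substitution and confluence *)

(** The delicate point is uniformity in the input. The cost of a linear variable is a number, fixed
    after [n] and merely added; a non-linear variable may be used many times, so its cost is a
    functional fixed before [n]. The rule [dial_arr_e] allows no linear variable in its argument,
    which is exactly what makes the cost of the argument independent of those numbers. Bodies of
    [Mu] and instances of [All] are linear, hence of ground cost type, so unfolding and
    instantiation never change the type of a cost functional. The functionals need not be effective:
    they are built with choice, and only the final polynomial matters. The other obstacle is eta:
    when a term applied to three arguments reduces to an answer, the term itself need not reduce to
    a Scott word. If the arguments are variables fresh for the term, the abstractions can be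
    recovered. The tail of the word may still contain the constants used for the previous letter,
    whence a new triple for each letter. The memory of the Turing machine does not record which
    triple a constant comes from, so one stored copy serves them all. *)

Lemma upr_ext r r' : r =1 r' -> upr r =1 upr r'.
Proof. by move=> E [|n] //=; rewrite E. Qed.

Lemma ups_ext s s' : s =1 s' -> ups s =1 ups s'.
Proof. by move=> E [|n] //=; rewrite E. Qed.

Lemma rename_ext r r' : r =1 r' -> rename r =1 rename r'.
Proof.
move=> E t; elim: t r r' E => [n|t IH|t IHt u IHu] r r' E /=.
- by rewrite E.
- by rewrite (IH _ _ (upr_ext E)).
- by rewrite (IHt _ _ E) (IHu _ _ E).
Qed.

Lemma subst_ext s s' : s =1 s' -> subst s =1 subst s'.
Proof.
move=> E t; elim: t s s' E => [n|t IH|t IHt u IHu] s s' E /=.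
- by rewrite E.
- by rewrite (IH _ _ (ups_ext E)).
- by rewrite (IHt _ _ E) (IHu _ _ E).
Qed.

Lemma subst_Var t : subst Var t = t.
Proof.
elim: t => [n|t IH|t IHt u IHu] //=; last by rewrite IHt IHu.
by congr Lam; rewrite -[RHS]IH; apply: subst_ext => -[].
Qed.

Lemma rename_subst_Var r t : rename r t = subst (fun n => Var (r n)) t.
Proof.
elim: t r => [n|t IH|t IHt u IHu] r //=; last by rewrite IHt IHu.
by rewrite IH; congr Lam; apply: subst_ext => -[].
Qed.

Lemma rename_id r t : r =1 id -> rename r t = t.
Proof.
move=> E; rewrite rename_subst_Var -[RHS]subst_Var.
by apply: subst_ext => n; rewrite E.
Qed.

Lemma subst_rename s r t : subst s (rename r t) = subst (s \o r) t.
Proof.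
elim: t s r => [n|t IH|t IHt u IHu] s r //=; last by rewrite IHt IHu.
by rewrite IH; congr Lam; apply: subst_ext => -[].
Qed.

Lemma rename_rename r r' t : rename r (rename r' t) = rename (r \o r') t.
Proof. by rewrite !(rename_subst_Var r) subst_rename rename_subst_Var. Qed.

Lemma rename_subst r s t : rename r (subst s t) = subst (rename r \o s) t.
Proof.
elim: t s r => [n|t IH|t IHt u IHu] s r //=; last by rewrite IHt IHu.
rewrite IH; congr Lam; apply: subst_ext => -[|n] //=.
by rewrite !rename_rename; apply: rename_ext.
Qed.

Lemma subst_subst s s' t : subst s (subst s' t) = subst (fun n => subst s (s' n)) t.
Proof.
elim: t s s' => [n|t IH|t IHt u IHu] s s' //=; last by rewrite IHt IHu.
rewrite IH; congr Lam; apply: subst_ext => -[|n] //=.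
by rewrite subst_rename rename_subst; apply: subst_ext.
Qed.

Definition scons (u : term) (s : nat -> term) (n : nat) : term :=
  if n is m.+1 then s m else u.

Lemma instE t u : inst t u = subst (scons u Var) t.
Proof. by apply: subst_ext => -[]. Qed.

Lemma inst_subst s t u : inst (subst (ups s) t) u = subst (scons u s) t.
Proof.
rewrite instE subst_subst; apply: subst_ext => -[|n] //=.
by rewrite subst_rename; apply: subst_Var.
Qed.

Lemma subst_inst s t u : subst s (inst t u) = inst (subst (ups s) t) (subst s u).
Proof.
by rewrite inst_subst instE subst_subst; apply: subst_ext => -[].
Qed.

Inductive par : term -> term -> Prop :=
| par_var n : par (Var n) (Var n)
| par_lam t t' : par t t' -> par (Lam t) (Lam t')
| par_app t t' u u' : par t t' -> par u u' -> par (App t u) (App t' u')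
| par_red t t' u u' : par t t' -> par u u' -> par (App (Lam t) u) (inst t' u').

Lemma par_refl t : par t t.
Proof. by elim: t => *; constructor. Qed.

Lemma par_subst t t' s s' :
  par t t' -> (forall n, par (s n) (s' n)) -> par (subst s t) (subst s' t').
Proof.
have par_rename r a a' : par a a' -> par (rename r a) (rename r a').
  move=> H; elim: H r => {a a'} [n|a a' _ IH|a a' b b' _ IHa _ IHb|
                                 a a' b b' _ IHa _ IHb] r /=.
  - exact: par_var.
  - exact/par_lam/IH.
  - exact: par_app.
  - rewrite [rename r (inst _ _)]rename_subst_Var subst_inst -!rename_subst_Var.
    have -> : subst (ups (fun n => Var (r n))) a' = rename (upr r) a'.
      by rewrite rename_subst_Var; apply: subst_ext => -[].
    exact: par_red.
move=> H; elim: H s s' => {t t'} [n|a a' _ IH|a a' b b' _ IHa _ IHb|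
                                 a a' b b' _ IHa _ IHb] s s' Hs //=.
- by apply/par_lam/IH => -[|n] /=; [apply: par_var | apply: par_rename].
- by apply: par_app; [apply: IHa | apply: IHb].
- rewrite subst_inst; apply: par_red; last exact: IHb.
  by apply: IHa => -[|n] /=; [apply: par_var | apply: par_rename].
Qed.

Lemma par_inst t t' u u' : par t t' -> par u u' -> par (inst t u) (inst t' u').
Proof.
by move=> Ht Hu; apply: par_subst Ht _ => -[|n] //; apply: par_refl.
Qed.

(** Takahashi's complete development: all redexes present in the term are contracted at once, so
    every parallel reduct of the term reduces to it in one parallel step. *)
Fixpoint dev (t : term) : term :=
  match t with
  | Var n => Var n
  | Lam u => Lam (dev u)
  | App (Lam a) u => inst (dev a) (dev u)
  | App a u => App (dev a) (dev u)
  end.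

Lemma par_dev t u : par t u -> par u (dev t).
Proof.
elim=> {t u} [n|t t' _ IH|t t' u u' Ht IHt _ IHu|t t' u u' _ IHt _ IHu].
- exact: par_refl.
- exact: par_lam.
- case: t Ht IHt => [n|a|a b] Ht IHt; try exact: par_app.
  inversion Ht as [|a1 a' Ha| |]; subst; inversion IHt; subst.
  exact: par_red.
- exact: par_inst.
Qed.

Notation reds := (clos_refl_trans term beta).

Lemma reds_lam t t' : reds t t' -> reds (Lam t) (Lam t').
Proof.
elim=> {t t'} [t t' H|t|t u v _ IH1 _ IH2];
  [by apply/rt_step/beta_lam | exact: rt_refl | exact: rt_trans IH1 IH2].
Qed.

Lemma reds_appl t t' u : reds t t' -> reds (App t u) (App t' u).
Proof.
elim=> {t t'} [t t' H|t|t1 t2 t3 _ IH1 _ IH2];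
  [by apply/rt_step/beta_appl | exact: rt_refl | exact: rt_trans IH1 IH2].
Qed.

Lemma reds_appr t u u' : reds u u' -> reds (App t u) (App t u').
Proof.
elim=> {u u'} [u u' H|u|u1 u2 u3 _ IH1 _ IH2];
  [by apply/rt_step/beta_appr | exact: rt_refl | exact: rt_trans IH1 IH2].
Qed.

Lemma beta_par t u : beta t u -> par t u.
Proof.
elim=> {t u} *; [apply: par_red | apply: par_lam | apply: par_app | apply: par_app] => //;
  exact: par_refl.
Qed.

Lemma par_reds t u : par t u -> reds t u.
Proof.
elim=> {t u} [n|t t' _ IH|t t' u u' _ IHt _ IHu|t t' u u' _ IHt _ IHu].
- exact: rt_refl.
- exact: reds_lam.
- exact: rt_trans (reds_appl _ IHt) (reds_appr _ IHu).
- apply: rt_trans (reds_appl _ (reds_lam IHt)) _.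
  by apply: rt_trans (reds_appr _ IHu) _; apply/rt_step/beta_red.
Qed.

Lemma reds_strip t u v : reds t u -> par t v -> exists2 x, par u x & reds v x.
Proof.
move=> H; elim: H v => {t u} [t u Htu|t|t u x _ IH1 _ IH2] v Htv.
- exists (dev t); first exact/par_dev/beta_par.
  exact/par_reds/par_dev.
- by exists v; [|apply: rt_refl].
- have [y Hy1 Hy2] := IH1 _ Htv; have [z Hz1 Hz2] := IH2 _ Hy1.
  by exists z => //; apply: rt_trans Hy2 Hz2.
Qed.

Lemma reds_confluent t u v : reds t u -> reds t v -> exists2 x, reds u x & reds v x.
Proof.
move=> H; elim: H v => {t u} [t u Htu|t|t u x _ IH1 _ IH2] v Htv.
- have [x Hx1 Hx2] := reds_strip Htv (beta_par Htu).
  by exists x => //; apply: par_reds.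
- by exists v => //; apply: rt_refl.
- have [y Hy1 Hy2] := IH1 _ Htv; have [z Hz1 Hz2] := IH2 _ Hy1.
  by exists z => //; apply: rt_trans Hy2 Hz2.
Qed.

Lemma reds_normal t u : normal t -> reds t u -> u = t.
Proof.
move=> Ht Htu; case: (clos_rt_rt1n _ _ _ _ Htu) Ht => // y z Hty _ /(_ y Hty) [].
Qed.

Lemma beta_normal_form_unique t u v :
  beta_normal_form t u -> beta_normal_form t v -> u = v.
Proof.
case=> [tu nu] [tv nv]; have [x ux vx] := reds_confluent tu tv.
by rewrite -(reds_normal nu ux) (reds_normal nv vx).
Qed.

Lemma scott_normal w : normal (scott w).
Proof.
elim: w => [|b w IH] u /= H;
  do 3 (inversion H as [|? ? H'| |]; subst; clear H; rename H' into H).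
- inversion H.
- inversion H as [| |? ? ? H'|? ? ? H']; subst.
  + inversion H'.
  + exact: IH H'.
Qed.

Lemma scott_inj : injective scott.
Proof.
elim=> [|b w IH] [|b' w'] //= [].
by case: b; case: b' => // _ /IH->.
Qed.

(** * Free variables and recovery of abstractions *)

Fixpoint fresh (k : nat) (t : term) : bool :=
  match t with
  | Var n => n != k
  | Lam u => fresh k.+1 u
  | App u v => fresh k u && fresh k v
  end.

(** Only an upper bound is wanted, so an abstraction does not lower the value. *)
Fixpoint fv_bound (t : term) : nat :=
  match t with
  | Var n => n.+1
  | Lam u => fv_bound u
  | App u v => maxn (fv_bound u) (fv_bound v)
  end.

Lemma fresh_ge t k : fv_bound t <= k -> fresh k t.
Proof.
elim: t k => [n|t IH|t IHt u IHu] k /=.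
- by move=> H; rewrite neq_ltn H.
- by move=> H; apply: IH; apply: leqW.
- by rewrite geq_max => /andP[/IHt-> /IHu->].
Qed.

Lemma fresh_rename r k t :
  (forall n, r n = r k -> n = k) -> fresh (r k) (rename r t) = fresh k t.
Proof.
elim: t r k => [n|t IH|t IHt u IHu] r k inj /=.
- by congr (~~ _); apply/eqP/eqP => [/inj//|->].
- by rewrite -(IH (upr r)) // => -[|n] //= [/inj->].
- by rewrite IHt // IHu.
Qed.

Lemma fresh_subst s k k' t :
  (forall n, n != k -> fresh k' (s n)) -> fresh k t -> fresh k' (subst s t).
Proof.
elim: t s k k' => [n|t IH|t IHt u IHu] s k k' Hs /=.
- exact: Hs.
- move=> Ht; apply: IH Ht => -[|n] //= nk.
  by rewrite (fresh_rename (r := S)) ?Hs // => m [].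
- by case/andP => Ht Hu; rewrite (IHt _ k) // (IHu _ k).
Qed.

Lemma fresh_beta k t u : beta t u -> fresh k t -> fresh k u.
Proof.
move=> H; elim: H k => {t u} [t u|t t' _ IH|t t' u _ IH|t u u' _ IH] k /=.
- case/andP=> Ht Hu; apply: fresh_subst Ht => -[|n] //=.
- exact: IH.
- by case/andP=> /IH-> ->.
- by case/andP=> -> /IH->.
Qed.

Lemma reds_rename r t u : reds t u -> reds (rename r t) (rename r u).
Proof.
rewrite !rename_subst_Var.
elim=> {t u} [t u /beta_par H|t|t u v _ IH1 _ IH2].
- by apply/par_reds/par_subst => // n; apply: par_refl.
- exact: rt_refl.
- exact: rt_trans IH1 IH2.
Qed.

Lemma lam_inst k t : fresh k.+1 t -> lam k (inst t (Var k)) = Lam t.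
Proof.
move=> Ht; congr Lam; rewrite instE rename_subst -[RHS]subst_Var.
suff E s s' : (forall n, n != k.+1 -> s n = s' n) -> subst s t = subst s' t.
  apply: E => -[|n] /=; first by rewrite eqxx.
  by rewrite eqSS => /negbTE->.
elim: t k.+1 Ht s s' => [n|a IH|a IHa b IHb] m /= Ht s s' E.
- exact: E.
- by rewrite (IH _ Ht _ (ups s')) // => -[|n] //= nm; rewrite E.
- by case/andP: Ht => Ha Hb; rewrite (IHa _ Ha _ s') // (IHb _ Hb _ s').
Qed.

(* The second case is the eta-expansion problem: [u] need not reduce to an
   abstraction. *)
Lemma reds_app_fresh k u v : fresh k u -> reds (App u (Var k)) v ->
  reds u (lam k v) \/ exists u', v = App u' (Var k).
Proof.
move=> fu Hr; move: (clos_rt_rt1n _ _ _ _ Hr) => {Hr}.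
move E: (App u (Var k)) => a H; elim: H u fu E => {a v} [a|a a' v Haa Hav IH] u fu Ea.
  by right; exists u.
rewrite -Ea in Haa.
inversion Haa as [b c Eb Ec| |b b' c Hb|b c c' Hc]; subst.
- left; rewrite -(lam_inst fu).
  exact/reds_lam/reds_rename/clos_rt1n_rt.
- have [Hr|[u' ->]] := IH _ (fresh_beta Hb fu) erefl; last by right; exists u'.
  by left; apply: rt_trans Hr; apply: rt_step.
- inversion Hc.
Qed.

(** * The Krivine machine and realizability *)

(* A closure [Cst i k] is the [i]-th of three constants, drawn from a fresh
   triple [k]. *)
Inductive clo : Type :=
| Cst of nat & nat
| Clo of term & seq clo.

Definition kstate : Type := clo * seq clo.

(* De Bruijn indices are looked up one environment cell at a time, so that every
   transition touches a bounded number of memory cells. *)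
Inductive kstep : kstate -> kstate -> Prop :=
| kstep_app t u e s : kstep (Clo (App t u) e, s) (Clo t e, Clo u e :: s)
| kstep_lam t e c s : kstep (Clo (Lam t) e, c :: s) (Clo t (c :: e), s)
| kstep_var0 c e s : kstep (Clo (Var 0) (c :: e), s) (c, s)
| kstep_varS i c e s : kstep (Clo (Var i.+1) (c :: e), s) (Clo (Var i) e, s).

Inductive ksteps : nat -> kstate -> kstate -> Prop :=
| ksteps0 s : ksteps 0 s s
| kstepsS n s1 s2 s3 : kstep s1 s2 -> ksteps n s2 s3 -> ksteps n.+1 s1 s3.

Definition sapp (s : kstate) (c : clo) : kstate := (s.1, rcons s.2 c).

Lemma kstep_sapp s s' c : kstep s s' -> kstep (sapp s c) (sapp s' c).
Proof. by case=> *; constructor. Qed.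

Lemma kstep_lookup d i e s : i < size e ->
  ksteps i.+1 (Clo (Var i) e, s) (nth d e i, s).
Proof.
elim: i e => [|i IH] [|c e] //= He.
  by apply: kstepsS (ksteps0 _); constructor.
by apply: kstepsS (IH _ He); constructor.
Qed.

(** An environment unloads to the substitution it denotes, which lowers the indices beyond it. The
    triple [k] becomes three consecutive variables starting at [3 * k], so any [k] at least the
    [fv_bound] of a term yields constants fresh for it. *)
Fixpoint unload (c : clo) : term :=
  match c with
  | Cst i k => Var (3 * k + i)
  | Clo t e => subst (foldr scons Var (map unload e)) t
  end.

Definition unload_state (s : kstate) : term :=
  foldl App (unload s.1) (map unload s.2).

Lemma reds_foldl t u ts : reds t u -> reds (foldl App t ts) (foldl App u ts).
Proof. by elim: ts t u => //= a ts IH t u H; apply/IH/reds_appl. Qed.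

Lemma unload_sapp s c : unload_state (sapp s c) = App (unload_state s) (unload c).
Proof. by rewrite /unload_state /= map_rcons foldl_rcons. Qed.

(** Only [kstep_lam] contracts a redex; the other transitions leave the unloaded term unchanged. *)
Lemma kstep_reds s s' : kstep s s' -> reds (unload_state s) (unload_state s').
Proof.
case=> *; rewrite /unload_state /=; try exact: rt_refl.
apply/reds_foldl/rt_step; rewrite -inst_subst; exact: beta_red.
Qed.

Lemma ksteps_reds n s s' : ksteps n s s' -> reds (unload_state s) (unload_state s').
Proof.
elim=> {n s s'} [s|n s1 s2 s3 /kstep_reds H _ IH]; first exact: rt_refl.
exact: rt_trans H IH.
Qed.

(** * Cost functionals and candidates *)

Notation npoly := {poly nat}.

Definition ev (n : nat) (p : npoly) : nat := p.[n]%R.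

Lemma evD n p q : ev n (p + q)%R = ev n p + ev n q.
Proof. by rewrite /ev hornerD. Qed.

Lemma evM n p q : ev n (p * q)%R = ev n p * ev n q.
Proof. by rewrite /ev hornerM. Qed.

Lemma evC n m : ev n m%:P%R = m.
Proof. by rewrite /ev hornerC. Qed.

Lemma evX n : ev n 'X%R = n.
Proof. by rewrite /ev hornerX. Qed.

Lemma ev0 n : ev n 0%R = 0.
Proof. by rewrite /ev horner0. Qed.

Definition evE := (evD, evM, evC, evX, ev0).

Inductive ty : Type := Base | Fun of ty & ty.

Fixpoint maj (a : ty) : Type :=
  match a with
  | Base => npoly
  | Fun a b => maj a -> maj b
  end.

Fixpoint addm (a : ty) : maj a -> npoly -> maj a :=
  match a return maj a -> npoly -> maj a with
  | Base => fun p q => (p + q)%R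
  | Fun a b => fun p q x => addm (p x) q
  end.

Lemma addmA a (p : maj a) q r : addm (addm p q) r = addm p (q + r)%R.
Proof.
elim: a p => [|a _ b IH] p /=; first by rewrite GRing.addrA.
by apply: functional_extensionality => x; apply: IH.
Qed.

Lemma addm0 a (p : maj a) : addm p 0%R = p.
Proof.
elim: a p => [|a _ b IH] p /=; first by rewrite GRing.addr0.
by apply: functional_extensionality => x; apply: IH.
Qed.

(* Only [Arr] contributes arrows: linear arguments are charged additively. *)
Fixpoint sk (A : form) : ty :=
  match A with
  | TVar _ | Mu _ => Base
  | All B => sk B
  | Lolli _ B => sk B
  | Arr B C => Fun (sk B) (sk C)
  end.

Lemma sk_linear L : is_linear L -> sk L = Base.
Proof. by elim: L => //= L _ M IH /andP[_]. Qed.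

Lemma sk_frename r A : sk (frename r A) = sk A.
Proof. by elim: A r => [i|A IH|A IH|A IHA B IHB|A IHA B IHB] r //=; rewrite ?IHA ?IHB. Qed.

Definition kpred : Type := kstate -> nat -> Prop.

(** Antireduction costs one unit per transition. Nothing here forces termination: that information
    enters when quantifiers are instantiated by [scott_reading] and [answers]. *)
Definition is_cand (X : kpred) : Prop :=
  (forall s m m', m <= m' -> X s m -> X s m') /\
  (forall s s' m, kstep s s' -> X s' m -> X s m.+1).

Definition vcons (X : kpred) (rho : nat -> kpred) (i : nat) : kpred :=
  if i is j.+1 then rho j else X.

Section Realizability.

Variable n : nat.

(* [sem A rho s p]: the machine state [s] realizes [A] at cost [p], a functional
   whose ground values are polynomials in the size [n] of the input. *)
Fixpoint sem (A : form) (rho : nat -> kpred) (s : kstate) (a : ty) :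
    maj a -> Prop :=
  match A with
  | TVar i =>
      match a return maj a -> Prop with
      | Base => fun p => rho i s (ev n p)
      | Fun _ _ => fun _ => False
      end
  | All B => fun p => forall X, is_cand X -> sem B (vcons X rho) s p
  | Mu B =>
      match a return maj a -> Prop with
      | Base => fun p => forall X, is_cand X ->
          (forall s' m, sem B (vcons X rho) s' (a := Base) m%:P%R -> X s' m) ->
          X s (ev n p)
      | Fun _ _ => fun _ => False
      end
  | Lolli L B => fun p => a = sk B /\ forall c q,
      sem L rho (c, [::]) (a := Base) q%:P%R ->
      sem B rho (sapp s c) (addm p q%:P%R)
  | Arr B C =>
      match a return maj a -> Prop with
      | Base => fun _ => False
      | Fun b c => fun p => forall d q,
          sem B rho (d, [::]) (a := b) q -> sem C rho (sapp s d) (p q)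
      end
  end.

(** [~~ occurs_only false i A] says that [i] has a positive occurrence, and
    [~~ occurs_only true i A] that it has a negative one. Inclusion is thus required in the
    direction dictated by the polarities that really occur; a variable with both needs both
    inclusions. *)
Lemma sem_mono A rho rho' s a (p : maj a) :
  (forall i s m, ~~ occurs_only false i A -> rho i s m -> rho' i s m) ->
  (forall i s m, ~~ occurs_only true i A -> rho' i s m -> rho i s m) ->
  sem A rho s p -> sem A rho' s p.
Proof.
elim: A rho rho' s a p => [k|A IH|A IH|A IHA B IHB|A IHA B IHB] rho rho' s a p Hp Hn /=.
- by case: a p => //= p; apply: Hp; rewrite /= eqxx.
- move=> H X cX; apply: IH (H X cX) => -[|i] // s' m; [exact: Hp | exact: Hn].
- case: a p => //= p H X cX HX; apply: H => // s' m Hs; apply: HX.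
  apply: IH Hs => -[|i] // s'' m'; [exact: Hp | exact: Hn].
- case=> sa H; split=> // c q Hq.
  apply: (IHB rho) => [i s' m Hi|i s' m Hi|].
  + by apply: Hp; rewrite /= negb_and Hi orbT.
  + by apply: Hn; rewrite /= negb_and Hi orbT.
  apply: H; apply: IHA Hq => i s' m Hi.
  + by apply: Hn; rewrite /= negb_and Hi.
  + by apply: Hp; rewrite /= negb_and Hi.
- case: a p => //= a b p H c q Hq.
  apply: (IHB rho) => [i s' m Hi|i s' m Hi|].
  + by apply: Hp; rewrite /= negb_and Hi orbT.
  + by apply: Hn; rewrite /= negb_and Hi orbT.
  apply: H; apply: IHA Hq => i s' m Hi.
  + by apply: Hn; rewrite /= negb_and Hi.
  + by apply: Hp; rewrite /= negb_and Hi.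
Qed.

Lemma sem_ext A rho rho' s a (p : maj a) :
  (forall i s m, rho i s m <-> rho' i s m) -> sem A rho s p <-> sem A rho' s p.
Proof. by move=> H; split; apply: sem_mono => i s' m _ /H. Qed.

Definition cands (rho : nat -> kpred) : Prop := forall i, is_cand (rho i).

Lemma cands_vcons X rho : is_cand X -> cands rho -> cands (vcons X rho).
Proof. by move=> HX H [|i]; [apply: HX | apply: H]. Qed.

(** Functionals are not ordered: costs are compared only between shifts of one and the same
    functional, and this is the only weakening of costs that adequacy uses. *)
Lemma sem_le A rho s a (p : maj a) Q Q' : cands rho -> ev n Q <= ev n Q' ->
  sem A rho s (addm p Q) -> sem A rho s (addm p Q').
Proof.
elim: A rho s a p => [k|A IH|A IH|A IHA B IHB|A IHA B IHB] rho s a p cr le /=.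
- case: a p => //= p; apply: (cr k).1.
  by rewrite !evD leq_add2l.
- move=> H X cX; apply: IH (H X cX) => //; exact: cands_vcons.
- case: a p => //= p H X cX HX; apply: (cX.1) (H X cX HX).
  by rewrite !evD leq_add2l.
- case=> sa H; split=> // c q /H.
  rewrite !addmA ![(_ + q%:P)%R]GRing.addrC -!addmA.
  exact: IHB.
- by case: a p => //= a b p H c q /H; apply: IHB.
Qed.

Lemma sem_le0 A rho s (p q : maj Base) : cands rho -> ev n p <= ev n q ->
  sem A rho s p -> sem A rho s q.
Proof.
move=> cr le; have := @sem_le A rho s Base 0%R p q cr le.
by rewrite /= !GRing.add0r.
Qed.

Lemma sem_addm A rho s a (p : maj a) Q : cands rho ->
  sem A rho s p -> sem A rho s (addm p Q).
Proof. by move=> cr; rewrite -{1}[p]addm0; apply: sem_le => //; rewrite ev0. Qed.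

Lemma sem_kstep A rho s s' a (p : maj a) : cands rho -> kstep s s' ->
  sem A rho s' p -> sem A rho s (addm p 1%:P%R).
Proof.
elim: A rho s s' a p => [k|A IH|A IH|A IHA B IHB|A IHA B IHB] rho s s' a p cr st /=.
- by case: a p => //= p; rewrite evD evC addn1; apply: (cr k).2.
- move=> H X cX; apply: IH (H X cX) => //; exact: cands_vcons.
- case: a p => //= p H X cX HX; rewrite evD evC addn1.
  exact: (cX.2) (H X cX HX).
- case=> sa H; split=> // c q /H; rewrite addmA GRing.addrC -addmA.
  exact/IHB/kstep_sapp.
- by case: a p => //= a b p H c q /H; apply/IHB/kstep_sapp.
Qed.

Lemma sem_ksteps A rho s s' a (p : maj a) m : cands rho -> ksteps m s s' ->
  sem A rho s' p -> sem A rho s (addm p m%:P%R).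
Proof.
move=> cr; elim=> {m s s'} [s|m s1 s2 s3 st _ IH] H.
  by apply: sem_addm.
have := sem_kstep cr st (IH H); rewrite addmA.
by apply: sem_le => //; rewrite evD !evC addn1.
Qed.

Definition sem_cand (A : form) (rho : nat -> kpred) : kpred :=
  fun s m => sem A rho s (a := Base) m%:P%R.

Lemma sem_candP A rho : cands rho -> is_cand (sem_cand A rho).
Proof.
move=> cr; split=> [s m m' le|s s' m st].
  by apply: sem_le0 => //; rewrite !evC.
move/(sem_kstep cr st); apply: sem_le0 => //=.
by rewrite evD !evC addn1.
Qed.

(** At ground type a polynomial matters only through its value at [n], so it may be traded for a
    constant. This lets formulas act as candidates, whose costs are numbers. *)
Lemma sem_candE A rho s (p : maj Base) : cands rho ->
  sem_cand A rho s (ev n p) <-> sem A rho s p.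
Proof. by move=> cr; split; apply: sem_le0 => //; rewrite evC. Qed.

Lemma sem_frename r A rho s a (p : maj a) :
  sem (frename r A) rho s p <-> sem A (fun i => rho (r i)) s p.
Proof.
have vc X (r' : nat -> nat) (rh : nat -> kpred) B s' a' (p' : maj a') :
    sem B (fun i => vcons X rh (upr r' i)) s' p' <->
    sem B (vcons X (fun i => rh (r' i))) s' p'.
  by apply: sem_ext => -[|i].
elim: A r rho s a p => [k|A IH|A IH|A IHA B IHB|A IHA B IHB] r rho s a p /=.
- by split.
- by split=> H X cX; [apply/vc/IH/H | apply/IH/vc/H].
- case: a p => //= p; split=> H X cX HX; apply: H => // s' m Hs; apply: HX.
    by apply/vc/IH.
  by apply/IH/vc.
- rewrite sk_frename; split=> -[sa H]; split=> // c q /IHA Hq; apply/IHB/H => //.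
- case: a p => //= a b p.
  by split=> H c q /IHA Hq; apply/IHB/H.
Qed.

(** The equation [a = sk B] in the [Lolli] clause of [sem] is there for this: without it an
    antecedent with no realizer would accept a functional of any type vacuously. The lemma settles
    the functional types when a linear formula replaces a type variable. *)
Lemma sem_linear_fun L rho s a b (p : maj (Fun a b)) :
  is_linear L -> ~ sem L rho s p.
Proof.
elim: L rho s a b p => [k|A IH|A IH|A IHA B IHB|A IHA B IHB] rho s a b p /=.
- by move=> _ [].
- by move=> lA H; apply: (IH _ _ _ _ _ lA (H (fun _ _ => True) _)).
- by move=> _ [].
- by case/andP=> _ /sk_linear-> [].
- by [].
Qed.

End Realizability.

Arguments sem n A rho s {a} p.

(** * Substitution of linear formulas *)

Lemma upr_inj r : injective r -> injective (upr r).
Proof. by move=> inj [|i] [|j] //= [/inj->]. Qed.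

Lemma occurs_only_frename r b k k' A : (forall i, (r i == k') = (i == k)) ->
  occurs_only b k' (frename r A) = occurs_only b k A.
Proof.
elim: A r b k k' => [i|A IH|A IH|A IHA B IHB|A IHA B IHB] r b k k' H /=.
- by rewrite H.
- by apply: IH => -[|i] //=; apply: H.
- by apply: IH => -[|i] //=; apply: H.
- by rewrite (IHA _ _ k) // (IHB _ _ k).
- by rewrite (IHA _ _ k) // (IHB _ _ k).
Qed.

Lemma occurs_only_frenameS b A : occurs_only b 0 (frename S A).
Proof.
suff H r k B : (forall i, r i != k) -> occurs_only b k (frename r B) by exact: H.
elim: B r k b => [i|B IH|B IH|B IHB C IHC|B IHB C IHC] r k b' H //=.
- by rewrite H orbT.
- by apply: IH => -[|i] //=; rewrite eqSS.
- by apply: IH => -[|i] //=; rewrite eqSS.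
- by rewrite IHB // IHC.
- by rewrite IHB // IHC.
Qed.

Lemma is_linear_frename r A : injective r -> is_linear (frename r A) = is_linear A.
Proof.
elim: A r => [i|A IH|A IH|A IHA B IHB|A IHA B IHB] r inj //=.
- exact/IH/upr_inj.
- rewrite (IH _ (upr_inj inj)) (occurs_only_frename _ (k := 0)) // => -[|i] //=.
- by rewrite IHA // IHB.
Qed.

Lemma is_formula_frename r A : injective r -> is_formula (frename r A) = is_formula A.
Proof.
elim: A r => [i|A IH|A IH|A IHA B IHB|A IHA B IHB] r inj //=.
- by rewrite is_linear_frename ?(IH _ (upr_inj inj)) //; apply: upr_inj.
- by have /= -> := is_linear_frename (Mu A) inj.
- by rewrite !is_linear_frename // IHB.
- by rewrite IHA // IHB.
Qed.

(** Asking [occurs_only b k' (s i)] for both values of [b] says that [k'] is absent from [s i], so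
    the only occurrences of [k'] in the result are those of [k] in [A]. *)
Lemma occurs_only_fsubst s b k k' A :
  (forall i, i != k -> forall b, occurs_only b k' (s i)) -> s k = TVar k' ->
  occurs_only b k A -> occurs_only b k' (fsubst s A).
Proof.
have up m j (s' : nat -> form) :
    (forall i, i != m -> forall b, occurs_only b j (s' i)) -> s' m = TVar j ->
    (forall i, i != m.+1 -> forall b, occurs_only b j.+1 (fups s' i)) /\
    fups s' m.+1 = TVar j.+1.
  move=> H /= ->; split=> // -[|i] //= im b'; first by case: b'.
  by rewrite (occurs_only_frename (r := S) _ (k := j)) ?H.
elim: A s b k k' => [i|A IH|A IH|A IHA B IHB|A IHA B IHB] s b k k' H E /=.
- by case: (eqVneq i k) => [-> |/H->//]; rewrite E /= !orbF => ->.
- by have [] := up _ _ _ H E; apply: IH.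
- by have [] := up _ _ _ H E; apply: IH.
- by case/andP=> HA HB; rewrite (IHA _ _ k) // (IHB _ _ k).
- by case/andP=> HA HB; rewrite (IHA _ _ k) // (IHB _ _ k).
Qed.

Lemma is_linear_fups s : (forall i, is_linear (s i)) -> forall i, is_linear (fups s i).
Proof. by move=> H [|i] //=; rewrite is_linear_frename // => a b []. Qed.

Lemma is_linear_fsubst s A :
  (forall i, is_linear (s i)) -> is_linear A -> is_linear (fsubst s A).
Proof.
elim: A s => [i|A IH|A IH|A IHA B IHB|A IHA B IHB] s Hs //=.
- exact/IH/is_linear_fups.
- case/andP=> lA oA; rewrite (IH _ (is_linear_fups Hs)) //=.
  apply: occurs_only_fsubst oA => // -[|i] //= _ b.
  exact: occurs_only_frenameS.
- by case/andP=> HA HB; rewrite IHA // IHB.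
Qed.

Lemma is_formula_linear A : is_linear A -> is_formula A.
Proof. by case: A => //= *; apply/orP; left. Qed.

Lemma is_formula_fsubst s A :
  (forall i, is_linear (s i)) -> is_formula A -> is_formula (fsubst s A).
Proof.
elim: A s => [i|A IH|A IH|A IHA B IHB|A IHA B IHB] s Hs /=.
- by move=> _; apply: is_formula_linear.
- case/orP=> [/(is_linear_fsubst (is_linear_fups Hs))->//|HA].
  by rewrite (IH _ (is_linear_fups Hs)) ?orbT.
- by rewrite !orbF => /(is_linear_fsubst (A := Mu A) Hs).
- case/orP=> [/(is_linear_fsubst (A := Lolli A B) Hs)/=->//|/andP[HA HB]].
  by rewrite (is_linear_fsubst Hs HA) IHB ?orbT.
- by case/andP=> HA HB; rewrite IHA // IHB.
Qed.

Lemma is_linear_finst A L : is_linear L -> is_linear A -> is_linear (finst A L).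
Proof. by move=> HL; apply: is_linear_fsubst => -[]. Qed.

Lemma is_formula_finst A L : is_linear L -> is_formula A -> is_formula (finst A L).
Proof. by move=> HL; apply: is_formula_fsubst => -[]. Qed.

Lemma sk_fsubst s A : (forall i, is_linear (s i)) -> sk (fsubst s A) = sk A.
Proof.
elim: A s => [i|A IH|A IH|A IHA B IHB|A IHA B IHB] s Hs //=.
- exact: sk_linear.
- exact/IH/is_linear_fups.
- exact: IHB.
- by rewrite IHA // IHB.
Qed.

Lemma sk_finst A L : is_linear L -> sk (finst A L) = sk A.
Proof. by move=> HL; apply: sk_fsubst => -[]. Qed.

(** The type index of [sem] is not computed from the formula, so the same [p] appears on both sides
    without transport along [sk_fsubst]. *)
Lemma sem_fsubst n sg A rho s a (p : maj a) :
  cands rho -> (forall i, is_linear (sg i)) ->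
  sem n (fsubst sg A) rho s p <-> sem n A (fun i => sem_cand n (sg i) rho) s p.
Proof.
have vc X tau (rh : nat -> kpred) B s' a' (p' : maj a') : is_cand X ->
    sem n B (fun i => sem_cand n (fups tau i) (vcons X rh)) s' p' <->
    sem n B (vcons X (fun i => sem_cand n (tau i) rh)) s' p'.
  move=> cX; apply: sem_ext => -[|i] s'' m; first by rewrite /sem_cand /= evC.
  exact: sem_frename.
elim: A sg rho s a p => [k|A IH|A IH|A IHA B IHB|A IHA B IHB] sg rho s a p cr lin /=.
- case: a p => [|a b] p; first by rewrite sem_candE.
  by split=> // H; case: (sem_linear_fun (lin k) H).
- have up := is_linear_fups lin.
  by split=> H X cX; have cr' := cands_vcons cX cr; [apply/vc/IH/H | apply/IH/vc/H].
- have up := is_linear_fups lin.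
  case: a p => //= p; split=> H X cX HX; have cr' := cands_vcons cX cr;
    apply: H => // s' m Hs; apply: HX; first by apply/vc/IH.
  by apply/IH/vc.
- by rewrite sk_fsubst //; split=> -[sa H]; split=> // c q /IHA Hq; apply/IHB/H/Hq.
- by case: a p => //= a b p; split=> H c q /IHA Hq; apply/IHB/H/Hq.
Qed.

Lemma sem_finst n A L rho s a (p : maj a) : cands rho -> is_linear L ->
  sem n (finst A L) rho s p <-> sem n A (vcons (sem_cand n L rho) rho) s p.
Proof.
move=> cr lin; rewrite sem_fsubst //; last by case.
by apply: sem_ext => -[|i] s' m //; rewrite /sem_cand /= evC.
Qed.

(** Knaster-Tarski on candidates. The intersection [M] of the pre-fixpoints is a pre-fixpoint by
    positivity ([FM]); its image under [L] is then a candidate and a pre-fixpoint too, hence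
    contains [M]. *)
Lemma sem_mu n L rho s (p : maj Base) : cands rho -> occurs_only true 0 L ->
  sem n (Mu L) rho s p <-> sem n L (vcons (sem_cand n (Mu L) rho) rho) s p.
Proof.
move=> cr pos; set M := sem_cand n (Mu L) rho.
have cM : is_cand M by exact: sem_candP.
have mono X Y s' (q : maj Base) : (forall s m, X s m -> Y s m) ->
    sem n L (vcons X rho) s' q -> sem n L (vcons Y rho) s' q.
  by move=> XY; apply: sem_mono => -[|i] s'' m //=; [move=> _; apply: XY | rewrite pos].
have leastM X : is_cand X ->
    (forall s m, sem_cand n L (vcons X rho) s m -> X s m) -> forall s m, M s m -> X s m.
  by move=> cX HX s' m /(_ X cX HX); rewrite evC.
have FM s' m : sem_cand n L (vcons M rho) s' m -> M s' m.
  move=> H X cX HX; rewrite evC; apply: (HX); apply: mono H => s'' m'.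
  exact: (leastM X cX HX).
rewrite -!sem_candE //; last exact: cands_vcons.
split; last exact: FM.
apply: leastM => [|s' m]; first exact/sem_candP/cands_vcons.
by apply: mono => s'' m'; apply: FM.
Qed.

(** * Adequacy *)

Lemma dom_cshift G : dom (cshift G) = dom G.
Proof. by rewrite /dom /cshift -map_comp. Qed.

Lemma In_dom x A G : List.In (x, A) G -> x \in dom G.
Proof.
elim: G => //= d G IH [->|/IH]; first by rewrite inE eqxx.
by rewrite inE orbC => ->.
Qed.

Lemma perm_dom G G' : Permutation G G' -> perm_eq (dom G) (dom G').
Proof.
elim=> {G G'} //= [d G G' _|d d' G|G1 G2 G3 _ H1 _ H2].
- by rewrite perm_cons.
- by apply/permP => P /=; rewrite addnCA.
- exact: perm_trans H1 H2.
Qed.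

(** Lets adequacy update a valuation at a bound or derelicted name without disturbing the other
    declarations. *)
Lemma dial_distinct G D t A : dial G D t A -> distinct G D.
Proof.
rewrite /distinct; elim=> {G D t A} //.
- by move=> G D t A _; rewrite !dom_cshift.
- by move=> G D z A t B _ /= /andP[].
- by move=> G D z L t B _ /=; apply: subseq_uniq; rewrite cat_subseq // subseq_cons.
- move=> G D x L t B _; rewrite (perm_uniq (s2 := dom ((x, L) :: G) ++ dom D)) //.
  by apply/permP => P; rewrite /= !count_cat /= addnCA.
- move=> G G' D D' t B pG pD _.
  by rewrite (perm_uniq (perm_cat (perm_dom pG) (perm_dom pD))).
Qed.

Definition wf_ctx (P : pred form) (G : ctx) : Prop :=
  forall x A, List.In (x, A) G -> P A.

Lemma In_cshift x A G : List.In (x, A) G -> List.In (x, frename S A) (cshift G).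
Proof. by elim: G => //= d G IH [->|/IH]; [left | right]. Qed.

Lemma cshift_In x A G : List.In (x, A) (cshift G) ->
  exists2 B, A = frename S B & List.In (x, B) G.
Proof.
rewrite /cshift; elim: G => //= -[y B] G IH /= [[<- <-]|/IH[C -> H]].
  by exists B; [|left].
by exists C; [|right].
Qed.

Lemma all_wf_ctx (P : pred form) G : all (fun d => P d.2) G -> wf_ctx P G.
Proof.
elim: G => [|[y B] G IH] /=; first by move=> _ x A.
by case/andP=> PB /IH H x A /= [[_ <-]|/H].
Qed.

Lemma wf_ctx_cat P G G' : wf_ctx P G -> wf_ctx P G' -> wf_ctx P (G ++ G').
Proof. by move=> H H' x A; case/List.in_app_iff => [/H|/H']. Qed.

(** Elimination rules have few formation premises; this recovers the positivity needed to unfold a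
    [Mu] and the linearity of the domain of a [Lolli]. *)
Lemma dial_wf G D t A : dial G D t A ->
  [/\ is_formula A, wf_ctx is_formula G & wf_ctx is_linear D].
Proof.
elim=> {G D t A}.
- by move=> x A HA; split=> // y B /= [[_ <-]|].
- by move=> x L HL; split=> [||y B /= [[_ <-]|]//] //; apply: is_formula_linear.
- move=> G D t L _ [/= HM HG HD]; split=> //.
  rewrite orbF in HM; apply: is_formula_linear; apply: is_linear_finst => //.
  by case/andP: HM.
- by move=> G D t L HL _ [_ HG HD]; split=> //; apply: is_formula_linear.
- move=> G D t A _ [HA HG HD]; split=> [|x B /In_cshift/HG|x B /In_cshift/HD].
  + by rewrite /= HA orbT.
  + by rewrite is_formula_frename // => ? ? [].
  + by rewrite is_linear_frename // => ? ? [].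
- move=> G D t A L HL _ [/= HA HG HD]; split=> //.
  apply: is_formula_finst => //.
  by case/orP: HA => // /is_formula_linear.
- move=> G1 G2 D t u A B _ _ [/= /andP[HA HB] HG1 HD] _ [_ HG2 _].
  by split=> //; apply: wf_ctx_cat.
- move=> G D z A t B _ [HB HG HD]; split=> // [|x C HC]; last by apply: (HG x); right.
  by rewrite /= HB (HG z) //; left.
- move=> G1 G2 D1 D2 t u L B _ _ [/= HB HG1 HD1] _ [_ HG2 HD2].
  split; [|exact: wf_ctx_cat|exact: wf_ctx_cat].
  by case/orP: HB => /andP[_ //]; apply: is_formula_linear.
- move=> G D z L t B _ [HB HG HD]; split=> // [|x C HC]; last by apply: (HD x); right.
  by rewrite /= HB (HD z) ?orbT //; left.
- move=> G D x y z A t B _ _ [HB HG HD]; split=> // w C /= [[_ <-]|HC].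
    by apply: (HG x); left.
  by apply: (HG w); right; right.
- move=> G D x L t B _ [HB HG HD]; split=> // [w C /= [[_ <-]|/HG//]|w C HC].
    by apply/is_formula_linear/(HD x); left.
  by apply: (HD w); right.
- move=> G G' D D' t B _ /all_wf_ctx HG' /all_wf_ctx HD' _ [HB HG HD].
  by split=> //; apply: wf_ctx_cat.
- move=> G G' D D' t B pG pD _ [HB HG HD]; split=> // x C HC.
    by apply: (HG x); apply: Permutation_in HC; apply: Permutation_sym.
  by apply: (HD x); apply: Permutation_in HC; apply: Permutation_sym.
Qed.

Lemma sum_Permutation (f : nat * form -> nat) D D' : Permutation D D' ->
  \sum_(d <- D) f d = \sum_(d <- D') f d.
Proof.
elim=> {D D'} // [d D D' _ IH|d d' D|D1 D2 D3 _ -> _ ->] //.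
- by rewrite !big_cons IH.
- by rewrite !big_cons addnCA.
Qed.

(** A functional packed with its type, so that one function on names assigns costs to a whole
    context. *)
Definition majorant : Type := {a : ty & maj a}.

Definition dummy : clo := Cst 0 0.

Definition tagged_for (g : nat -> majorant) (G : ctx) : Prop :=
  forall x B, List.In (x, B) G -> projT1 (g x) = sk B.

(* A lookup at index i takes i + 1 transitions, and [R] bounds it independently
   of [r]. *)
Definition valid n R rho (r : nat -> nat) e g (del : nat -> nat) (G D : ctx) : Prop :=
  [/\ cands rho,
      forall x B, List.In (x, B) G \/ List.In (x, B) D -> r x < R /\ r x < size e,
      forall x B, List.In (x, B) G ->
        sem n B rho (nth dummy e (r x), [::]) (projT2 (g x)) &
      forall x L, List.In (x, L) D ->
        sem n L rho (nth dummy e (r x), [::]) (a := Base) (del x)%:P%R].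

Definition cost (del : nat -> nat) (D : ctx) : nat := \sum_(d <- D) del d.1.

Lemma cost_cat del D D' : cost del (D ++ D') = cost del D + cost del D'.
Proof. exact: big_cat. Qed.

Lemma majorant_cast (m : majorant) A : projT1 m = sk A ->
  exists q : maj (sk A), forall n rho s, sem n A rho s (projT2 m) -> sem n A rho s q.
Proof. by case: m => a p /= E; move: p; rewrite E => p; exists p. Qed.

Lemma valid_sub n R rho r e g del G D G' D' :
  (forall x B, List.In (x, B) G' -> List.In (x, B) G) ->
  (forall x B, List.In (x, B) D' -> List.In (x, B) D) ->
  valid n R rho r e g del G D -> valid n R rho r e g del G' D'.
Proof.
move=> sG sD [cr Hr HG HD].
split=> // [x B H|x B /sG|x B /sD]; [|exact: HG|exact: HD].
by apply: (Hr x B); case: H => [/sG|/sD]; [left | right].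
Qed.

Definition upd (T : Type) (f : nat -> T) (z : nat) (v : T) (x : nat) : T :=
  if x == z then v else f x.

Lemma cost_upd del z v D : z \notin dom D -> cost (upd del z v) D = cost del D.
Proof.
rewrite /cost /upd; elim: D => [|d D IH] /=; first by rewrite !big_nil.
by rewrite inE negb_or eq_sym => /andP[/negbTE nz /IH H]; rewrite !big_cons nz H.
Qed.

Definition bind (r : nat -> nat) (z x : nat) : nat :=
  if x == z then 0 else (r x).+1.

Lemma rename_bind r z t :
  rename (upr r) (rename (fun n => if n == z then 0 else n.+1) t) = rename (bind r z) t.
Proof.
rewrite rename_rename; apply: rename_ext => x /=.
by rewrite /bind; case: eqP.
Qed.

(** The order of quantifiers is the point: [u] is found from [R] and [g] alone, before the input
    size, the environment and the costs [del] of the linear variables, which are only added at the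
    end. [R] grows by one under each binder because [bind] shifts the lookup indices. *)
Lemma adequacy G D t A : dial G D t A ->
  forall R g, tagged_for g G -> exists u : maj (sk A),
  forall n rho r e del, valid n R rho r e g del G D ->
  sem n A rho (Clo (rename r t) e, [::]) (addm u (cost del D)%:P%R).
Proof.
have lookup R (r : nat -> nat) (e : seq clo) x n B rho a (p : maj a) :
    cands rho -> r x < R -> r x < size e ->
    sem n B rho (nth dummy e (r x), [::]) p ->
    sem n B rho (Clo (Var (r x)) e, [::]) (addm p R%:P%R).
  move=> cr rR re H.
  apply: sem_le (sem_ksteps cr (kstep_lookup dummy [::] re) H) => //.
  by rewrite !evC.
elim=> {G D t A}.
- move=> x A HA R g Hg.
  have [q Hq] := majorant_cast (Hg x A (or_introl erefl)).
  exists (addm q R%:P%R) => n rho r e del [cr Hr HG _] /=.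
  rewrite /cost big_nil addm0.
  have [rR re] := Hr x A (or_introl (or_introl erefl)).
  by apply/lookup => //; apply/Hq/HG; left.
- move=> x L HL R g _; rewrite (sk_linear HL).
  exists (R%:P%R : maj Base) => n rho r e del [cr Hr _ HD].
  rewrite /cost big_seq1 /=.
  have [rR re] := Hr x L (or_intror (or_introl erefl)).
  rewrite GRing.addrC; apply: (lookup R r e x n L rho Base) => //.
  by apply: HD; left.
- move=> G D t L dt IH R g /(IH R g)[u Hu].
  have [/= HM _ _] := dial_wf dt; rewrite orbF in HM; case/andP: (HM) => HL pos.
  rewrite sk_finst // (sk_linear HL); exists u => n rho r e del V.
  have [cr _ _ _] := V.
  by rewrite sem_finst // -sem_mu //; apply: Hu.
- move=> G D t L HM _ IH R g /(IH R g)[]; rewrite sk_finst //.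
  case/andP: (HM) => HL pos; rewrite (sk_linear HL) => u Hu.
  exists u => n rho r e del V; have [cr _ _ _] := V.
  by rewrite sem_mu // -sem_finst //; apply: Hu.
- move=> G D t A _ IH R g Hg.
  have [x B /cshift_In[C -> /Hg]|u Hu] := IH R g; first by rewrite sk_frename.
  exists u => n rho r e del [cr Hr HG HD] X cX.
  have -> : cost del D = cost del (cshift D) by rewrite /cost big_map.
  apply: Hu; split.
  + exact: cands_vcons.
  + move=> x B [] /cshift_In[C _ HC]; apply: (Hr x C); [left|right]; exact: HC.
  + by move=> x B /cshift_In[C -> HC]; rewrite sem_frename; apply: HG.
  + by move=> x B /cshift_In[C -> HC]; rewrite sem_frename; apply: HD.
- move=> G D t A L HL _ IH R g /(IH R g)[u Hu].
  rewrite sk_finst //; exists u => n rho r e del V.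
  have [cr _ _ _] := V.
  by rewrite sem_finst //; apply: Hu V _ _; apply: sem_candP.
- move=> G1 G2 D t u A B _ _ IH1 _ IH2 R g Hg.
  have [x C HC|p Hp] := IH1 R g; first by apply: Hg; apply/List.in_app_iff; left.
  have [x C HC|q Hq] := IH2 R g; first by apply: Hg; apply/List.in_app_iff; right.
  exists (addm (p q) 1%:P%R) => n rho r e del V.
  have [cr _ _ _] := V.
  have V1 : valid n R rho r e g del G1 D.
    by apply: valid_sub V => // x C HC; apply/List.in_app_iff; left.
  have V2 : valid n R rho r e g del G2 [::].
    by apply: valid_sub V => // x C HC; apply/List.in_app_iff; right.
  have := Hp _ _ _ _ _ V1 _ _ (Hq _ _ _ _ _ V2).
  (* The linear context of the argument is empty, so [q] itself, with no [del] added, is the cost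
     given to [p]. *)
  rewrite /cost big_nil addm0 => H.
  rewrite addmA GRing.addrC -addmA; apply: sem_kstep H => //; exact: kstep_app.
- move=> G D z A t B dt IH R g Hg.
  have /= := dial_distinct dt; rewrite /distinct /= mem_cat negb_or.
  case/andP=> /andP[zG zD] _.
  have nG x C : List.In (x, C) G -> (x == z) = false.
    by move=> /In_dom HC; apply: contraNF zG => /eqP<-.
  have nD x C : List.In (x, C) D -> (x == z) = false.
    by move=> /In_dom HC; apply: contraNF zD => /eqP<-.
  have IHq (q : maj (sk A)) : exists u : maj (sk B),
      forall n rho r e del,
      valid n R.+1 rho r e (upd g z (existT maj (sk A) q)) del ((z, A) :: G) D ->
      sem n B rho (Clo (rename r t) e, [::]) (addm u (cost del D)%:P%R).
    apply: IH => x C /=; rewrite /upd => -[[<- <-]|HC]; first by rewrite eqxx.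
    by rewrite (nG _ _ HC); apply: Hg.
  (* The induction hypothesis provides a cost for the body for each cost [q] of the argument; choice
     turns this into a functional. *)
  pose f q := proj1_sig (constructive_indefinite_description _ (IHq q)).
  have Hf q := proj2_sig (constructive_indefinite_description _ (IHq q)).
  exists (fun q => addm (f q) 1%:P%R) => n rho r e del [cr Hr HG HD] c q Hq.
  rewrite rename_bind /= addmA GRing.addrC -addmA.
  apply: sem_kstep (kstep_lam _ _ _ _) _ => //; apply: Hf; split=> //.
  + move=> x C; rewrite /bind /= => -[[[<- _]|HC]|HC]; first by rewrite eqxx.
      by rewrite (nG _ _ HC); apply: (Hr x C); left.
    by rewrite (nD _ _ HC); apply: (Hr x C); right.
  + move=> x C /=; rewrite /bind /upd => -[[<- <-]|HC]; first by rewrite eqxx.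
    by rewrite (nG _ _ HC); apply: HG.
  + by move=> x C HC; rewrite /bind (nD _ _ HC); apply: HD.
- move=> G1 G2 D1 D2 t u L B _ dt IH1 _ IH2 R g Hg.
  have [/= HLB _ _] := dial_wf dt.
  have HL : is_linear L by case/orP: HLB => /andP[].
  have [x C HC|p Hp] := IH1 R g; first by apply: Hg; apply/List.in_app_iff; left.
  have [x C HC|] := IH2 R g; first by apply: Hg; apply/List.in_app_iff; right.
  rewrite (sk_linear HL) => q Hq.
  exists (addm p (q + 1%:P)%R) => n rho r e del V.
  have [cr _ _ _] := V.
  have V1 : valid n R rho r e g del G1 D1.
    by apply: valid_sub V => // x C HC; apply/List.in_app_iff; left.
  have V2 : valid n R rho r e g del G2 D2.
    by apply: valid_sub V => // x C HC; apply/List.in_app_iff; right.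
  have [_ H] := Hp _ _ _ _ _ V1.
  (* The linear argument is passed at its numerical cost at [n], which includes [cost del D2]; the
     sum over [D1 ++ D2] is restored below. *)
  have Hu : sem_cand n L rho (Clo (rename r u) e, [::])
      (ev n (addm (a := Base) q (cost del D2)%:P%R)).
    by apply/sem_candE => //; apply: Hq.
  have {H Hu} := H _ _ Hu => H.
  have := sem_kstep cr (kstep_app _ _ _ _) H; rewrite cost_cat !addmA.
  by apply: sem_le => //; rewrite !(evE, evD n q) /=; lia.
- move=> G D z L t B dt IH R g Hg.
  have := dial_distinct dt; rewrite /distinct /= uniq_catC /= mem_cat negb_or.
  case/andP=> /andP[zD zG] _.
  have nG x C : List.In (x, C) G -> (x == z) = false.
    by move=> /In_dom HC; apply: contraNF zG => /eqP<-.
  have nD x C : List.In (x, C) D -> (x == z) = false.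
    by move=> /In_dom HC; apply: contraNF zD => /eqP<-.
  have [u Hu] := IH R.+1 g Hg.
  exists (addm u 1%:P%R) => n rho r e del [cr Hr HG HD].
  rewrite /= rename_bind; split=> // c q Hq.
  have V : valid n R.+1 rho (bind r z) (c :: e) g (upd del z q) G ((z, L) :: D).
    split=> //.
    + move=> x C; rewrite /bind /= => -[HC|[[<- _]|HC]]; last first.
      * by rewrite (nD _ _ HC); apply: (Hr x C); right.
      * by rewrite eqxx.
      * by rewrite (nG _ _ HC); apply: (Hr x C); left.
    + by move=> x C HC; rewrite /bind (nG _ _ HC); apply: HG.
    + move=> x C /=; rewrite /bind /upd => -[[<- <-]|HC]; first by rewrite eqxx.
      by rewrite (nD _ _ HC); apply: HD.
  have := Hu _ _ _ _ _ V.
  have -> : cost (upd del z q) ((z, L) :: D) = q + cost del D.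
    by rewrite /cost big_cons -/(cost _ _) cost_upd // /upd eqxx.
  move/(sem_kstep cr (kstep_lam _ _ _ _)); rewrite !addmA.
  by apply: sem_le => //; rewrite !evE; lia.
- move=> G D x y z A t B dz dt IH R g Hg.
  have := dial_distinct dt; move: dz; rewrite /distinct /= !inE !mem_cat !negb_or.
  case/andP=> /andP[zG zD] _ /and3P[/and3P[xy xG xD] /andP[yG yD] _].
  set f := fun m : nat => if (m == x) || (m == y) then z else m.
  have fG w C : List.In (w, C) G -> f w = w.
    move/In_dom=> HC; rewrite /f; case: eqP => [E|_]; first by rewrite -E HC in xG.
    by case: eqP => [E|//]; rewrite -E HC in yG.
  have fD w C : List.In (w, C) D -> f w = w.
    move/In_dom=> HC; rewrite /f; case: eqP => [E|_]; first by rewrite -E HC in xD.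
    by case: eqP => [E|//]; rewrite -E HC in yD.
  have fx : f x = z by rewrite /f eqxx.
  have fy : f y = z by rewrite /f eqxx orbT.
  (* Both copies read the environment cell and the functional of [z]; costs in [G] are never summed,
     so contraction is free. *)
  have [w C /=|u Hu] := IH R (g \o f).
    case=> [[<- <-]|[[<- <-]|HC]]; rewrite ?fx ?fy; try by apply: Hg; left.
    by rewrite (fG _ _ HC); apply: Hg; right.
  exists u => n rho r e del [cr Hr HG HD]; rewrite rename_rename.
  apply: Hu; split=> //.
  + move=> w C /= [[[<- _]|[[<- _]|HC]]|HC]; rewrite ?fx ?fy.
    * by apply: (Hr z A); left; left.
    * by apply: (Hr z A); left; left.
    * by rewrite (fG _ _ HC); apply: (Hr w C); left; right.
    * by rewrite (fD _ _ HC); apply: (Hr w C); right.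
  + move=> w C /= [[<- <-]|[[<- <-]|HC]]; rewrite ?fx ?fy; try by apply: HG; left.
    by rewrite (fG _ _ HC); apply: HG; right.
  + by move=> w C HC /=; rewrite (fD _ _ HC); apply: HD.
- move=> G D x L t B dt IH R g Hg.
  have [_ _ HD] := dial_wf dt.
  have HL : is_linear L by apply: (HD x); left.
  have := dial_distinct dt; rewrite /distinct /= uniq_catC /= mem_cat negb_or.
  case/andP=> /andP[xD xG] _.
  have nD y C : List.In (y, C) D -> (y == x) = false.
    by move=> /In_dom HC; apply: contraNF xD => /eqP<-.
  have [w C HC|u Hu] := IH R g; first by apply: Hg; right.
  have [] := majorant_cast (Hg x L (or_introl erefl)).
  rewrite (sk_linear HL) => q Hq.
  (* The linear hypothesis is given the numerical cost [ev n q]; charging the polynomial [q] in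
     advance keeps the functional independent of [n]. *)
  exists (addm u q) => n rho r e del [cr Hr HG HD'].
  have V : valid n R rho r e g (upd del x (ev n q)) G ((x, L) :: D).
    split=> //.
    + move=> y C /= [HC|[HC|HC]]; apply: (Hr y C);
        by [left; right | left; left | right].
    + by move=> y C HC; apply: HG; right.
    + move=> y C /=; rewrite /upd => -[[<- <-]|HC].
        by rewrite eqxx; apply/sem_candE => //; apply/Hq/HG; left.
      by rewrite (nD _ _ HC); apply: HD'.
  have := Hu _ _ _ _ _ V; rewrite addmA.
  have -> : cost (upd del x (ev n q)) ((x, L) :: D) = ev n q + cost del D.
    by rewrite /cost big_cons -/(cost _ _) cost_upd // /upd eqxx.
  by apply: sem_le => //; rewrite evD !evC.
- move=> G G' D D' t B _ _ _ _ IH R g Hg.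
  have [w C HC|u Hu] := IH R g; first by apply: Hg; apply/List.in_app_iff; left.
  exists u => n rho r e del V; have [cr _ _ _] := V.
  have V1 : valid n R rho r e g del G D.
    by apply: valid_sub V => x C HC; apply/List.in_app_iff; left.
  move: (Hu _ _ _ _ _ V1); apply: sem_le => //.
  by rewrite !evC cost_cat leq_addr.
- move=> G G' D D' t B pG pD _ IH R g Hg.
  have pG' w C : List.In (w, C) G -> List.In (w, C) G' by apply: Permutation_in.
  have pD' w C : List.In (w, C) D -> List.In (w, C) D' by apply: Permutation_in.
  have [w C /pG'|u Hu] := IH R g; first exact: Hg.
  exists u => n rho r e del V.
  by rewrite /cost -(sum_Permutation _ pD); apply: Hu; apply: valid_sub V.
Qed.

(** * Church and Scott words *)

Lemma cand_ksteps X m s s' p : is_cand X -> ksteps m s s' -> X s' p -> X s (m + p).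
Proof. by move=> [_ cX]; elim=> {m s s'} // m s1 s2 s3 st _ IH /IH/(cX _ _ _ st). Qed.

(** Each letter costs one [kstep_app] and a lookup of index 1 or 2, at most 4 transitions in all.
    The final 4 is three [kstep_lam] and the lookup of index 0. *)
Lemma church_realizes w rho :
  sem (size w) WChurch rho (Clo (church w) [::], [::]) (a := Fun Base (Fun Base Base))
    (fun p q => ('X * (p + q + 4%:P) + 4%:P)%R).
Proof.
set n := size w => X cX c0 q0 [_ H0] c1 q1 [_ H1]; split=> // c q Hq.
rewrite /= in H0 H1 Hq *; rewrite !evE.
have {}H0 d m : X (d, [::]) m -> X (c0, [:: d]) (ev n q0 + m).
  by move=> Hd; have := H0 d m; rewrite evD !evC; apply.
have {}H1 d m : X (d, [::]) m -> X (c1, [:: d]) (ev n q1 + m).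
  by move=> Hd; have := H1 d m; rewrite evD !evC; apply.
rewrite evC in Hq.
have body v : X (Clo (foldr (fun b u => App (letter b) u) (Var 0) v)
                   [:: c; c1; c0], [::]) (size v * (ev n q0 + ev n q1 + 4) + q + 1).
  elim: v => [|b v IH] /=.
    by rewrite mul0n add0n addn1; apply: (cX.2) Hq; constructor.
  set d := Clo _ _ in IH; case: b.
    suff: X (Clo (App (Var 1) (foldr (fun b u => App (letter b) u) (Var 0) v))
        [:: c; c1; c0], [::]) (3 + (ev n q1 + (size v * (ev n q0 + ev n q1 + 4) + q + 1))).
      by apply: (cX.1); rewrite mulSn; lia.
    apply: cand_ksteps (H1 _ _ IH) => //.
    apply: kstepsS (kstep_app _ _ _ _) _.
    exact: (@kstep_lookup dummy 1).
  suff: X (Clo (App (Var 2) (foldr (fun b u => App (letter b) u) (Var 0) v))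
      [:: c; c1; c0], [::]) (4 + (ev n q0 + (size v * (ev n q0 + ev n q1 + 4) + q + 1))).
    by apply: (cX.1); rewrite mulSn; lia.
  apply: cand_ksteps (H0 _ _ IH) => //.
  apply: kstepsS (kstep_app _ _ _ _) _.
  exact: (@kstep_lookup dummy 2).
apply: (cX.1) (cand_ksteps (m := 3) cX _ (body w)); last first.
  do 3 (apply: kstepsS (kstep_lam _ _ _ _) _); exact: ksteps0.
by rewrite -/n; lia.
Qed.

(** * Reading a Scott word off a state *)

Definition probe (s : kstate) (k : nat) : kstate :=
  sapp (sapp (sapp s (Cst 0 k)) (Cst 1 k)) (Cst 2 k).

(** Each letter has its own triple [k], as the remaining closure needs constants fresh for it. The
    cost bounds the transitions of all the probes together. *)
Inductive reads : kstate -> nat -> word -> Prop :=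
| reads_nil s k m m' :
    ksteps m (probe s k) (Cst 2 k, [::]) -> m <= m' -> reads s m' [::]
| reads_cons s k (b : bool) c w m1 m2 m :
    ksteps m1 (probe s k) (Cst b k, [:: c]) -> reads (c, [::]) m2 w ->
    m1 + m2 <= m -> reads s m (b :: w).

Lemma reads_le s m m' w : m <= m' -> reads s m w -> reads s m' w.
Proof.
move=> le H; case: H le => [s' k m1 m2 st le1|s' k b c w' m1 m2 m3 st r le1] le.
  by apply: reads_nil st _; apply: leq_trans le.
by apply: reads_cons st r _; apply: leq_trans le.
Qed.

Lemma reads_kstep s s' m w : kstep s s' -> reads s' m w -> reads s m.+1 w.
Proof.
move=> st H; case: H st => [s1 k m1 m2 st1 le1|s1 k b c w' m1 m2 m3 st1 r le1] st.
  apply: reads_nil (kstepsS _ st1) _; last exact: le1.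
  by do 3 apply: kstep_sapp.
apply: reads_cons (kstepsS _ st1) r _; last by rewrite addSn ltnS.
by do 3 apply: kstep_sapp.
Qed.

(** The reading bounds the running time and the reduction gives the normal form; they are kept
    together because a single [w] must serve both. *)
Definition scott_reading : kpred :=
  fun s m => exists2 w, reads s m w & reds (unload_state s) (scott w).

Lemma scott_reading_cand : is_cand scott_reading.
Proof.
split=> [s m m' le [w r t]|s s' m st [w r t]]; exists w => //.
- exact: reads_le r.
- exact: reads_kstep r.
- exact: rt_trans (kstep_reds st) t.
Qed.

(** The candidate for the quantified variable inside [WScott]: the computation reaches a constant of
    the triple [k], and after a letter the tail can already be read. *)
Definition answers (k : nat) : kpred := fun s m =>
  (exists2 m1, m1 <= m & ksteps m1 s (Cst 2 k, [::])) \/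
  exists b : bool, exists c m1 m2,
    [/\ ksteps m1 s (Cst b k, [:: c]), scott_reading (c, [::]) m2 & m1 + m2 <= m].

Lemma answers_cand k : is_cand (answers k).
Proof.
split=> [s m m' le|s s' m st].
  case=> [[m1 le1 H]|[b [c [m1 [m2 [H1 H2 le1]]]]]].
    by left; exists m1 => //; apply: leq_trans le.
  by right; exists b, c, m1, m2; split=> //; apply: leq_trans le.
case=> [[m1 le1 H]|[b [c [m1 [m2 [H1 H2 le1]]]]]].
  by left; exists m1.+1 => //; apply: kstepsS H.
by right; exists b, c, m1.+1, m2; split=> //; apply: kstepsS H1.
Qed.

(** [reds_app_fresh] is used from the last variable to the first. Its second case must be excluded
    by hypothesis only once: afterwards the reduct is an abstraction. *)
Lemma reds_probe u k v : fv_bound u <= k ->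
  reds (App (App (App u (Var k)) (Var k.+1)) (Var k.+2)) v ->
  (forall u', v <> App u' (Var k.+2)) ->
  reds u (lam k (lam k.+1 (lam k.+2 v))).
Proof.
move=> le H nv.
have f1 : fresh k u by exact: fresh_ge.
have f2 : fresh k.+1 (App u (Var k)).
  by rewrite /= fresh_ge ?(leqW le) //= neq_ltn ltnSn.
have f3 : fresh k.+2 (App (App u (Var k)) (Var k.+1)).
  by rewrite /= fresh_ge ?(leqW (leqW le)) //= !neq_ltn !ltnS leqnSn leqnn.
case: (reds_app_fresh f3 H) => [{}H|[u' /nv//]].
case: (reds_app_fresh f2 H) => [{}H|[u' //]].
by case: (reds_app_fresh f1 H) => [//|[u' //]].
Qed.

Lemma rename_scott w r : rename r (scott w) = scott w.
Proof. by elim: w r => //= b w IH r; rewrite IH; case: b. Qed.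

Lemma lam_scott k (b : bool) w :
  lam k (lam k.+1 (lam k.+2 (App (Var (k + b)) (scott w)))) = scott (b :: w).
Proof.
rewrite /lam /= !rename_scott.
do 3 congr Lam; congr App; congr Var.
case: b => /=; rewrite ?addn1 ?addn0.
  by rewrite (ltn_eqF (ltnSn k.+1)) /= eqxx.
by rewrite (ltn_eqF (leqnSn k.+1)) /= (ltn_eqF (ltnSn k)) /= eqxx.
Qed.

Lemma lam_scott_nil k : lam k (lam k.+1 (lam k.+2 (Var k.+2))) = scott [::].
Proof. by rewrite /lam /= eqxx. Qed.

(** Minimality of [Mu] is applied to [scott_reading], then the quantifier is instantiated by
    [answers k]. *)
Lemma scott_reading_sound n rho s m : cands rho ->
  sem n WScott rho s (a := Base) m%:P%R -> scott_reading s m.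
Proof.
move=> cr H; rewrite -[m](evC n); apply: H; first exact: scott_reading_cand.
move=> {}s {}m H.
pose k := fv_bound (unload_state s).
have {H} [_ H] := H _ (answers_cand k).
have ans (b : bool) : forall c q, scott_reading (c, [::]) (ev n q%:P%R) ->
    answers k (sapp (Cst b k, [::]) c) (ev n (0 + q%:P)%R).
  move=> c q Hc; right; exists b, c, 0, q; split; first exact: ksteps0.
    by rewrite evC in Hc.
  by rewrite !evE.
(* The constants realize their types at cost 0, so the probe costs no more than [m]. *)
have {H} [_ H] := H (Cst 0 k) 0 (conj erefl (ans false)).
have {H} [_ H] := H (Cst 1 k) 0 (conj erefl (ans true)).
have {H} := H (Cst 2 k) 0; rewrite !evE !addn0 => H.
have {H} : answers k (probe s k) m.
  by apply: H; left; exists 0 => //; apply: ksteps0.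
have le : fv_bound (unload_state s) <= 3 * k by rewrite /k; lia.
have pr : unload_state (probe s k) =
    App (App (App (unload_state s) (Var (3 * k))) (Var (3 * k).+1)) (Var (3 * k).+2).
  by rewrite /probe !unload_sapp /= addn0 addn1 addn2.
case=> [[m1 le1 st]|[b [c [m1 [m2 [st [w r t] le1]]]]]].
  exists [::]; first exact: reads_nil st le1.
  have uZ : unload_state (Cst 2 k, [::]) = Var (3 * k).+2.
    by rewrite /unload_state /= addn2.
  have := ksteps_reds st; rewrite pr uZ => /(reds_probe le) H.
  by rewrite -(lam_scott_nil (3 * k)); apply: H.
exists (b :: w); first exact: reads_cons st r le1.
have := ksteps_reds st; rewrite pr => Hs.
have {Hs} /(reds_probe le) H := rt_trans _ _ _ _ _ Hs (reds_appr _ t).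
rewrite -(lam_scott (3 * k)); apply: H.
(* A Scott word is an abstraction, so the reduct is not an application to a variable. *)
by case: (w).
Qed.

Theorem church_scott_reads t : dial [::] [::] t (Arr WChurch WScott) ->
  exists P : npoly, forall w, exists2 w2,
    reads (Clo t [::], [:: Clo (church w) [::]]) (ev (size w) P) w2 &
    reds (App t (church w)) (scott w2).
Proof.
move=> /adequacy/(_ 0 (fun=> existT maj Base 0%R)) [] // u Hu.
exists (u (fun p q => ('X * (p + q + 4%:P) + 4%:P)%R)) => w.
set P : maj Base := u _.
pose rho : nat -> kpred := fun _ _ _ => True.
have cr : cands rho by [].
have V : valid (size w) 0 rho id [::] (fun=> existT maj Base 0%R) (fun=> 0) [::] [::].
  by split=> // x B [].
have H := Hu _ _ _ _ _ V; rewrite /cost big_nil addm0 rename_id // in H.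
have {}H : sem (size w) WScott rho (Clo t [::], [:: Clo (church w) [::]]) (a := Base) P.
  exact: (H _ _ (@church_realizes w rho)).
have [w2 r] : scott_reading (Clo t [::], [:: Clo (church w) [::]]) (ev (size w) P).
  apply: (scott_reading_sound (n := size w) cr).
  by apply: sem_le0 H => //; rewrite evC.
move=> Hr; exists w2 => //.
by rewrite -[t]subst_Var -[church w]subst_Var.
Qed.

(** * Stack programs on Turing machines *)

(** While programs on stacks of bits, one stack per tape. A test sees the top bit, or [None] on an
    empty stack. *)
Inductive prog : Type :=
| Skip
| Push of nat & bool
| Pop of nat
| Seq of prog & prog
| If of nat & pred (option bool) & prog & prog
| While of nat & pred (option bool) & prog.

Definition stacks : Type := nat -> seq bool.

(* [n] is an upper bound on the number of steps of [prog_TM]. *)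
Inductive exec : prog -> stacks -> nat -> stacks -> Prop :=
| exec_skip m n : 0 < n -> exec Skip m n m
| exec_push i b m n : 1 < n -> exec (Push i b) m n (upd m i (b :: m i))
| exec_pop i b s m n : m i = b :: s -> 0 < n -> exec (Pop i) m n (upd m i s)
| exec_seq p q m1 m2 m3 n1 n2 n :
    exec p m1 n1 m2 -> exec q m2 n2 m3 -> n1 + n2 <= n -> exec (Seq p q) m1 n m3
| exec_if_true i (c : pred (option bool)) p q m m' n n' :
    c (ohead (m i)) -> exec p m n m' -> n < n' -> exec (If i c p q) m n' m'
| exec_if_false i (c : pred (option bool)) p q m m' n n' :
    ~~ c (ohead (m i)) -> exec q m n m' -> n < n' -> exec (If i c p q) m n' m'
| exec_while_false i (c : pred (option bool)) p m n :
    ~~ c (ohead (m i)) -> 0 < n -> exec (While i c p) m n m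
| exec_while_true i (c : pred (option bool)) p m1 m2 m3 n1 n2 n :
    c (ohead (m1 i)) -> exec p m1 n1 m2 -> exec (While i c p) m2 n2 m3 ->
    n1 + n2 < n -> exec (While i c p) m1 n m3.

(** Control points: [None] is the test of an [If] or a [While], and the two booleans are the two
    phases of a [Push]. *)
Fixpoint st (p : prog) : finType :=
  match p with
  | Skip | Pop _ => unit
  | Push _ _ => bool
  | Seq p q => (st p + st q)%type
  | If _ _ p q => option (st p + st q)
  | While _ _ p => option (st p)
  end.

Fixpoint st_start (p : prog) : st p :=
  match p return st p with
  | Skip | Pop _ => tt
  | Push _ _ => false
  | Seq p _ => inl (st_start p)
  | If _ _ _ _ | While _ _ _ => None
  end.

Fixpoint bounded_by (k : nat) (p : prog) : bool :=
  match p with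
  | Skip => true
  | Push i _ | Pop i => i <= k
  | Seq p q => bounded_by k p && bounded_by k q
  | If i _ p q => [&& i <= k, bounded_by k p & bounded_by k q]
  | While i _ p => (i <= k) && bounded_by k p
  end.

Section Delta.

Variables (k : nat) (aux : finType).

Local Notation sym := (option (bool + aux)).
Local Notation scans := {ffun 'I_k.+1 -> sym}.
Local Notation acts := {ffun 'I_k.+1 -> sym * direction}.

Definition act_on (h : scans) (i : nat) (a : option sym) (d : direction) : acts :=
  [ffun j : 'I_k.+1 => if val j == i then (odflt (h j) a, d) else (h j, MoveN)].

Definition idle (h : scans) : acts := [ffun j => (h j, MoveN)].

Definition top_bit (a : sym) : option bool :=
  if a is Some (inl b) then Some b else None.

(* The successor state [None] means that the program has terminated. *)
Fixpoint pdelta (p : prog) : st p -> scans -> option (st p) * acts :=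
  match p return st p -> scans -> option (st p) * acts with
  | Skip => fun _ h => (None, idle h)
  | Push i b => fun x h =>
      if x then (None, act_on h i (Some (Some (inl b))) MoveN)
      else (Some true, act_on h i None MoveL)
  | Pop i => fun _ h => (None, act_on h i None MoveR)
  | Seq p q => fun x h =>
      match x with
      | inl y => let: (o, a) := pdelta y h in
          (Some (if o is Some y' then inl y' else inr (st_start q)), a)
      | inr y => let: (o, a) := pdelta y h in (omap inr o, a)
      end
  | If i c p q => fun x h =>
      match x with
      | None => (Some (Some (if c (top_bit (h (inord i))) then inl (st_start p)
                             else inr (st_start q))), idle h)
      | Some (inl y) => let: (o, a) := pdelta y h in (omap (fun z => Some (inl z)) o, a)
      | Some (inr y) => let: (o, a) := pdelta y h in (omap (fun z => Some (inr z)) o, a)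
      end
  | While i c p => fun x h =>
      match x with
      | None => (if c (top_bit (h (inord i))) then Some (Some (st_start p)) else None,
                 idle h)
      | Some y => let: (o, a) := pdelta y h in (Some o, a)
      end
  end.

End Delta.

Section Run.

Variable M : TM.

Local Notation k := (ntapes M).

Definition tapes : Type := 'I_k.+1 -> tape M.

Definition scan (T : tapes) : {ffun 'I_k.+1 -> symbol M} := [ffun i => scanned (T i)].

Definition perform (a : {ffun 'I_k.+1 -> symbol M * direction}) (T : tapes) : tapes :=
  fun i => move (a i).2 (write (a i).1 (T i)).

Inductive goes (p : prog) : st p -> tapes -> nat -> tapes -> Prop :=
| goes_exit x T a :
    pdelta x (scan T) = (None, a) -> goes x T 1 (perform a T)
| goes_step x y T a n T' :
    pdelta x (scan T) = (Some y, a) -> goes y (perform a T) n T' -> goes x T n.+1 T'.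

Lemma perform_idle T : perform (idle (scan T)) T = T.
Proof.
apply: functional_extensionality => i; rewrite /perform !ffunE /=.
by case: (T i).
Qed.

Lemma goes_inr p q (x : st q) T n T' :
  goes x T n T' -> goes (p := Seq p q) (inr x) T n T'.
Proof.
elim=> {x T n T'} [x T a E|x y T a n T' E _ IH].
  by apply: goes_exit; rewrite /= E.
by apply: goes_step IH; rewrite /= E.
Qed.

Lemma goes_seq p q (x : st p) T n T' n' T'' :
  goes x T n T' -> goes (st_start q) T' n' T'' ->
  goes (p := Seq p q) (inl x) T (n + n') T''.
Proof.
move=> H; elim: H n' T'' => {x T n T'} [x T a E|x y T a n T' E _ IH] n' T'' H.
  by apply: goes_step (goes_inr p H); rewrite /= E.
by rewrite addSn; apply: goes_step (IH _ _ H); rewrite /= E.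
Qed.

Lemma goes_if_inl i c p q (x : st p) T n T' :
  goes x T n T' -> goes (p := If i c p q) (Some (inl x)) T n T'.
Proof.
elim=> {x T n T'} [x T a E|x y T a n T' E _ IH].
  by apply: goes_exit; rewrite /= E.
by apply: goes_step IH; rewrite /= E.
Qed.

Lemma goes_if_inr i c p q (x : st q) T n T' :
  goes x T n T' -> goes (p := If i c p q) (Some (inr x)) T n T'.
Proof.
elim=> {x T n T'} [x T a E|x y T a n T' E _ IH].
  by apply: goes_exit; rewrite /= E.
by apply: goes_step IH; rewrite /= E.
Qed.

Lemma goes_while i c p (x : st p) T n T' n' T'' :
  goes x T n T' -> goes (p := While i c p) None T' n' T'' ->
  goes (p := While i c p) (Some x) T (n + n') T''.
Proof.
move=> H; elim: H n' T'' => {x T n T'} [x T a E|x y T a n T' E _ IH] n' T'' H.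
  by apply: goes_step H; rewrite /= E.
by rewrite addSn; apply: goes_step (IH _ _ H); rewrite /= E.
Qed.

(* A stack is the block of bits under the head and to its right: pushing is
   moving left and then writing, popping is moving right. *)
Definition tape_stack (tp : tape M) : seq bool := leading_bits (scanned tp :: rcells tp).

Definition rel (m : stacks) (T : tapes) : Prop := forall i, tape_stack (T i) = m i.

Lemma rel_top m T i : rel m T -> i <= k ->
  top_bit (scan T (inord i)) = ohead (m i).
Proof.
move=> R ik; rewrite ffunE; have := R (inord i); rewrite inordK // => <-.
by rewrite /tape_stack /=; case: (scanned _) => [[]|].
Qed.

(** A popped bit stays on the tape left of the head, outside the stack, until a later push
    overwrites it. *)
Lemma exec_goes p m n m' T : exec p m n m' -> bounded_by k p -> rel m T ->
  exists n' T', [/\ n' <= n, goes (st_start p) T n' T' & rel m' T'].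
Proof.
move=> H; elim: H T => {p m n m'}.
- move=> m n n0 T _ R; exists 1, T; split=> //.
  by rewrite -{2}[T]perform_idle; apply: goes_exit.
- move=> i b m n n1 T ik R; exists 2; eexists; split=> //.
    by apply: goes_step; [|apply: goes_exit].
  move=> j; rewrite /upd /perform /tape_stack !ffunE.
  case: eqP => [ji|nji] /=; last by rewrite -R /tape_stack; case: (T j).
  by rewrite -ji -R; case: (T j).
- move=> i b s m n mi n0 T ik R; exists 1; eexists; split=> //; first exact: goes_exit.
  move=> j; rewrite /upd /perform /tape_stack !ffunE.
  case: eqP => [ji|nji] /=; last by rewrite -R /tape_stack; case: (T j).
  have := R j; rewrite ji mi /tape_stack; case: (T j) => l a r /=.
  by case: a => [[a|a]|] //= [_ <-]; case: r.
- move=> p q m1 m2 m3 n1 n2 n _ IH1 _ IH2 le T /= /andP[bp bq] R.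
  have [n1' [T1 [le1 G1 R1]]] := IH1 T bp R.
  have [n2' [T2 [le2 G2 R2]]] := IH2 T1 bq R1.
  exists (n1' + n2'), T2; split=> //; last exact: goes_seq G1 G2.
  by apply: leq_trans le; apply: leq_add.
- move=> i c p q m m' n n' ci _ IH le T /= /and3P[ik bp bq] R.
  have [n1 [T1 [le1 G1 R1]]] := IH T bp R.
  exists n1.+1, T1; split=> //; first exact: leq_ltn_trans le.
  apply: goes_step; first by rewrite /= (rel_top R ik) ci.
  by rewrite perform_idle; apply: goes_if_inl.
- move=> i c p q m m' n n' ci _ IH le T /= /and3P[ik bp bq] R.
  have [n1 [T1 [le1 G1 R1]]] := IH T bq R.
  exists n1.+1, T1; split=> //; first exact: leq_ltn_trans le.
  apply: goes_step; first by rewrite /= (rel_top R ik) (negbTE ci).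
  by rewrite perform_idle; apply: goes_if_inr.
- move=> i c p m n ci n0 T /= /andP[ik bp] R; exists 1, T; split=> //.
  rewrite -{2}[T]perform_idle; apply: goes_exit.
  by rewrite /= (rel_top R ik) (negbTE ci).
- move=> i c p m1 m2 m3 n1 n2 n ci _ IH1 _ IH2 le T /= /andP[ik bp] R.
  have [n1' [T1 [le1 G1 R1]]] := IH1 T bp R.
  have [|n2' [T2 [le2 G2 R2]]] := IH2 T1 _ R1; first by rewrite /= ik.
  exists (n1' + n2').+1, T2; split=> //.
    by apply: leq_ltn_trans le; apply: leq_add.
  apply: goes_step; first by rewrite /= (rel_top R ik) ci.
  by rewrite perform_idle; apply: goes_while G1 G2.
Qed.

End Run.

Definition prog_TM (k : nat) (p : prog) : TM :=
  @Build_TM k (option (st p)) void (Some (st_start p)) (fun q => ~~ isSome q)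
    (fun q h => if q is Some x then pdelta x h else (None, idle h)).

Lemma goes_iter k p (x : st p) T n T' : @goes (prog_TM k p) p x T n T' ->
  iter n (@tm_step (prog_TM k p)) (Config (M := prog_TM k p) (Some x) T) =
  Config (M := prog_TM k p) None T'.
Proof.
elim=> {x T n T'} [x T a E|x y T a n T' E _ IH].
  rewrite /= /tm_step /=; move: E; rewrite /scan => ->.
  by [].
rewrite iterSr -IH; congr iter; rewrite /tm_step /=.
by move: E; rewrite /scan => ->.
Qed.

Definition init_stacks (w : word) : stacks := upd (fun=> [::]) 0 w.

Lemma rel_init k p w : rel (M := prog_TM k p) (init_stacks w) (ctapes (tm_init (prog_TM k p) w)).
Proof.
move=> i; rewrite /init_stacks /upd /tape_stack /tm_init /=.
have -> : (i == ord0) = (val i == 0) by [].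
case: eqP => // _; rewrite /tape_of_word /=.
by case: w => //= b w; congr cons; elim: w => //= b' w ->.
Qed.

Lemma polytime_prog (f : word -> word) k p (P : npoly) :
  bounded_by k p ->
  (forall w, exists2 m, exec p (init_stacks w) (ev (size w) P) m & m k = f w) ->
  polytime f.
Proof.
move=> bp H; exists (prog_TM k p), P => w; have [m Hm mk] := H w.
have [n [T [le G R]]] := exec_goes (M := prog_TM k p) Hm bp (@rel_init k p w).
exists n => //; rewrite /tm_init (goes_iter G) /=; split=> //.
by rewrite -mk -[RHS](R ord_max).
Qed.

(** * The Krivine machine as a stack program *)

Lemma exec_le p m n n' m' : exec p m n m' -> n <= n' -> exec p m n' m'.
Proof.
case=> {p m n m'}.
- by move=> m n n0 le; apply: exec_skip; apply: leq_trans le.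
- by move=> i b m n n1 le; apply: exec_push; apply: leq_trans le.
- by move=> i b s m n mi n0 le; apply: exec_pop mi _; apply: leq_trans le.
- by move=> p q m1 m2 m3 n1 n2 n e1 e2 le1 le; apply: exec_seq e1 e2 _; apply: leq_trans le.
- by move=> i c p q m m' n n1 ci e le1 le; apply: exec_if_true ci e _; apply: leq_trans le.
- by move=> i c p q m m' n n1 ci e le1 le; apply: exec_if_false ci e _; apply: leq_trans le.
- by move=> i c p m n ci n0 le; apply: exec_while_false ci _; apply: leq_trans le.
- move=> i c p m1 m2 m3 n1 n2 n ci e1 e2 le1 le.
  by apply: exec_while_true ci e1 e2 _; apply: leq_trans le.
Qed.

Lemma exec_then p q m1 m2 m3 n1 n2 :
  exec p m1 n1 m2 -> exec q m2 n2 m3 -> exec (Seq p q) m1 (n1 + n2) m3.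
Proof. by move=> e1 e2; apply: exec_seq e1 e2 _. Qed.

Definition is_one : pred (option bool) := fun o => o == Some true.
Definition is_empty : pred (option bool) := fun o => o == None.

(** Reading a unary register empties it; to keep the value, the ones are transferred to a spare
    register as well and then moved back. *)
Definition move_ones (i : nat) (js : seq nat) : prog :=
  While i is_one (Seq (Pop i) (foldr (fun j p => Seq (Push j true) p) Skip js)).

Definition put (js : seq nat) (s : seq bool) (m : stacks) : stacks :=
  foldr (fun j m => upd m j (s ++ m j)) m js.

Lemma putE js s m j : uniq js -> put js s m j = if j \in js then s ++ m j else m j.
Proof.
elim: js => //= i js IH /andP[ijs /IH{}IH].
rewrite /upd inE; case: eqP => [->|_] //=.
have -> : put js s m i = m i.
  elim: js ijs {IH} => //= i' js IH; rewrite inE negb_or => /andP[/negbTE E /IH H].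
  by rewrite /upd E.
by [].
Qed.

Lemma upd_eq (T : Type) (f : nat -> T) i v : upd f i v i = v.
Proof. by rewrite /upd eqxx. Qed.

Lemma exec_push_all js m : uniq js ->
  exec (foldr (fun j p => Seq (Push j true) p) Skip js) m (2 * size js + 1) (put js [:: true] m).
Proof.
elim: js m => [|j js IH] m /=; first by move=> _; apply: exec_skip.
move=> u; have /andP[njs ujs] := u.
have -> : upd (put js [:: true] m) j (true :: put js [:: true] m j) =
          put js [:: true] (upd m j (true :: m j)).
  apply: functional_extensionality => i.
  rewrite {1}/upd !putE // /upd; case: eqP => [->|_] //.
  by rewrite (negbTE njs).
apply: exec_seq (exec_push j true m (ltnSn 1)) (IH _ ujs) _.
by rewrite mulnS.
Qed.

Lemma exec_move_ones i js v s m : i \notin js -> uniq js ->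
  m i = nseq v true ++ s -> ~~ is_one (ohead s) ->
  exec (move_ones i js) m (v * (2 * size js + 3) + 1) (put js (nseq v true) (upd m i s)).
Proof.
move=> ijs ujs; elim: v m => [|v IH] m mi ns.
  have -> : put js (nseq 0 true) (upd m i s) = m.
    apply: functional_extensionality => j; rewrite putE // if_same.
    by rewrite /upd; case: eqP => // ->; rewrite mi.
  by apply: exec_while_false; rewrite ?mi.
set m1 := put js [:: true] (upd m i (nseq v true ++ s)).
have m1i : m1 i = nseq v true ++ s by rewrite /m1 putE // (negbTE ijs) upd_eq.
have -> : put js (nseq v.+1 true) (upd m i s) = put js (nseq v true) (upd m1 i s).
  apply: functional_extensionality => j; rewrite !putE // /upd.
  case: (j =P i) => [->|nji]; first by rewrite (negbTE ijs).
  rewrite /m1 putE // /upd; case: ifP => // _; case: eqP => // _.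
  by rewrite -addn1 nseqD -catA.
apply: exec_while_true (IH _ m1i ns) _; first by rewrite mi.
  apply: exec_then (exec_push_all _ ujs).
  by apply: (exec_pop (b := true) (n := 1)); rewrite // mi.
by rewrite mulSn; lia.
Qed.

Definition pour (i j : nat) : prog :=
  While i isSome (If i is_one (Seq (Pop i) (Push j true)) (Seq (Pop i) (Push j false))).

Lemma exec_pour i j m : i != j ->
  exec (pour i j) m (5 * size (m i) + 1) (upd (upd m i [::]) j (catrev (m i) (m j))).
Proof.
move=> ij; move E: (m i) => s; elim: s m E => [|b s IH] m E.
  have -> : upd (upd m i [::]) j (catrev [::] (m j)) = m.
    apply: functional_extensionality => l; rewrite /upd.
    by case: eqP => [->|_] //; case: eqP => [->|].
  by apply: exec_while_false; rewrite ?E.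
set m1 := upd (upd m i s) j (b :: upd m i s j).
have m1i : m1 i = s by rewrite /m1 /upd (negbTE ij) eqxx.
have -> : upd (upd m i [::]) j (catrev (b :: s) (m j)) =
          upd (upd m1 i [::]) j (catrev s (m1 j)).
  apply: functional_extensionality => l; rewrite /m1 /upd.
  case: eqP => [_|nlj]; last by case: eqP.
  by rewrite eqxx eq_sym (negbTE ij).
apply: (@exec_while_true i isSome _ m m1 _ 4) (IH _ m1i) _; first by rewrite E.
  have e1 : exec (Pop i) m 1 (upd m i s) by apply: exec_pop E _.
  case: b {IH} E @m1 m1i e1 => E m1 m1i e1.
    by apply: exec_if_true (exec_then e1 (exec_push _ _ _ (ltnSn 1))) _; rewrite ?E.
  by apply: exec_if_false (exec_then e1 (exec_push _ _ _ (ltnSn 1))) _; rewrite ?E.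
by rewrite /=; lia.
Qed.

Definition reg (j : nat) : nat := j + 5.

(* Stacks: 0 the input, 1 the memory, 2 scratch, 3 the run flag, 4 the reversed
   output, and then registers in unary. *)
Definition cfg (inp h g f o : seq bool) (r : seq nat) : stacks := fun i =>
  if i < 5 then nth [::] [:: inp; h; g; f; o] i else nseq (nth 0 r (i - 5)) true.

Lemma cfg_reg inp h g f o r j : cfg inp h g f o r (reg j) = nseq (nth 0 r j) true.
Proof. by rewrite /cfg /reg ltnNge leq_addl addnK. Qed.

Lemma upd_cfg_reg inp h g f o r j v :
  upd (cfg inp h g f o r) (reg j) (nseq v true) = cfg inp h g f o (set_nth 0 r j v).
Proof.
apply: functional_extensionality => i; rewrite /upd /cfg /reg nth_set_nth /=.
case: ltnP => i5.
  by case: eqP => // Ei; move: i5; rewrite Ei ltnNge leq_addl.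
by rewrite -(eqn_add2r 5 (i - 5)) subnK //; case: eqP.
Qed.

Lemma upd_cfg0 inp h g f o r s : upd (cfg inp h g f o r) 0 s = cfg s h g f o r.
Proof. by apply: functional_extensionality; do 5 case=> //. Qed.

Lemma upd_cfg1 inp h g f o r s : upd (cfg inp h g f o r) 1 s = cfg inp s g f o r.
Proof. by apply: functional_extensionality; do 5 case=> //. Qed.

Lemma upd_cfg2 inp h g f o r s : upd (cfg inp h g f o r) 2 s = cfg inp h s f o r.
Proof. by apply: functional_extensionality; do 5 case=> //. Qed.

Lemma upd_cfg3 inp h g f o r s : upd (cfg inp h g f o r) 3 s = cfg inp h g s o r.
Proof. by apply: functional_extensionality; do 5 case=> //. Qed.

Lemma upd_cfg4 inp h g f o r s : upd (cfg inp h g f o r) 4 s = cfg inp h g f s r.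
Proof. by apply: functional_extensionality; do 5 case=> //. Qed.

Definition add_reg (v : nat) (j : nat) (r : seq nat) : seq nat :=
  set_nth 0 r j (nth 0 r j + v).

Lemma put_cfg inp h g f o r v js :
  put (map reg js) (nseq v true) (cfg inp h g f o r) =
  cfg inp h g f o (foldr (add_reg v) r js).
Proof.
by elim: js => //= j js IH; rewrite IH cfg_reg -nseqD addnC upd_cfg_reg.
Qed.

Lemma reg_inj : injective reg.
Proof. by move=> i j /addIn. Qed.

Lemma exec_move i js inp h g f o r : i \notin js -> uniq js ->
  exec (move_ones (reg i) (map reg js)) (cfg inp h g f o r)
    (nth 0 r i * (2 * size js + 3) + 1)
    (cfg inp h g f o (foldr (add_reg (nth 0 r i)) (set_nth 0 r i 0) js)).
Proof.
move=> ijs ujs.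
have := @exec_move_ones (reg i) (map reg js) (nth 0 r i) [::] (cfg inp h g f o r).
rewrite (mem_map reg_inj) (map_inj_uniq reg_inj) size_map cats0 cfg_reg.
move=> /(_ ijs ujs erefl isT).
by rewrite (upd_cfg_reg _ _ _ _ _ _ _ 0) put_cfg.
Qed.

Lemma reg_gt1 i js : i < 5 -> i \notin map reg js.
Proof.
move=> i5; apply/mapP => -[j _ E]; move: i5.
by rewrite E /reg ltnNge leq_addl.
Qed.

Lemma exec_store_move i js inp h g f o r : i \notin js -> uniq js ->
  exec (move_ones (reg i) (1 :: map reg js)) (cfg inp h g f o r)
    (nth 0 r i * (2 * size js + 5) + 1)
    (cfg inp (nseq (nth 0 r i) true ++ h) g f o
       (foldr (add_reg (nth 0 r i)) (set_nth 0 r i 0) js)).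
Proof.
move=> ijs ujs.
have := @exec_move_ones (reg i) (1 :: map reg js) (nth 0 r i) [::] (cfg inp h g f o r).
rewrite inE (mem_map reg_inj) /= (map_inj_uniq reg_inj) size_map cats0 cfg_reg reg_gt1 //.
have -> : (reg i == 1) = false by apply/eqP; rewrite /reg; lia.
rewrite ijs ujs => /(_ isT isT erefl isT).
rewrite (upd_cfg_reg _ _ _ _ _ _ _ 0) put_cfg upd_cfg1 /=.
by move/exec_le; apply; lia.
Qed.

Lemma exec_scratch_move js inp h v g f o r : uniq js ->
  exec (move_ones 2 (1 :: map reg js)) (cfg inp h (nseq v true ++ false :: g) f o r)
    (v * (2 * size js + 5) + 1)
    (cfg inp (nseq v true ++ h) (false :: g) f o (foldr (add_reg v) r js)).
Proof.
move=> ujs.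
have := @exec_move_ones 2 (1 :: map reg js) v (false :: g)
          (cfg inp h (nseq v true ++ false :: g) f o r).
rewrite inE /= (map_inj_uniq reg_inj) size_map !reg_gt1 // ujs.
move=> /(_ isT isT erefl isT).
rewrite upd_cfg2 put_cfg upd_cfg1 /=.
by move/exec_le; apply; lia.
Qed.

Lemma exec_push_mem b inp h g f o r :
  exec (Push 1 b) (cfg inp h g f o r) 2 (cfg inp (b :: h) g f o r).
Proof. by have := @exec_push 1 b (cfg inp h g f o r) 2 isT; rewrite upd_cfg1. Qed.

Lemma exec_pop_scratch b inp h g f o r :
  exec (Pop 2) (cfg inp h (b :: g) f o r) 1 (cfg inp h g f o r).
Proof.
by have := @exec_pop 2 b g (cfg inp h (b :: g) f o r) 1 erefl isT; rewrite upd_cfg2.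
Qed.

(** * Memory nodes and their access *)

Definition node : Type := nat * nat * nat.

Definition enc_field (v : nat) : seq bool := rcons (nseq v true) false.

Definition enc_node (x : node) : seq bool :=
  enc_field x.1.1 ++ enc_field x.1.2 ++ enc_field x.2.

(** The memory stack holds the reverse of this list: addresses count from the bottom, and appending
    a node only pushes bits. *)
Definition enc (heap : seq node) : seq bool := flatten (map enc_node heap).

Definition field (js : seq nat) : prog :=
  Seq (move_ones 2 (1 :: map reg js)) (Seq (Pop 2) (Push 1 false)).

Lemma exec_field js inp h v g f o r : uniq js ->
  exec (field js) (cfg inp h (enc_field v ++ g) f o r)
    (v * (2 * size js + 5) + 4)
    (cfg inp (catrev (enc_field v) h) g f o (foldr (add_reg v) r js)).
Proof.
move=> ujs; rewrite /enc_field cat_rcons catrevE rev_rcons rev_nseq.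
apply: exec_seq (exec_scratch_move _ _ _ _ _ _ _ ujs) _ _.
- exact: exec_then (exec_pop_scratch _ _ _ _ _ _ _) (exec_push_mem _ _ _ _ _ _ _).
- by rewrite -addnA.
Qed.

Definition node_at (heap : seq node) (p : nat) (x : node) : Prop :=
  p < size heap /\ nth (0, 0, 0) heap p = x.

Definition skip_node : prog := Seq (field [::]) (Seq (field [::]) (field [::])).

Lemma exec_skip_node inp h x g f o r :
  exec skip_node (cfg inp h (enc_node x ++ g) f o r)
    (5 * size (enc_node x)) (cfg inp (catrev (enc_node x) h) g f o r).
Proof.
case: x => [[a b] c]; rewrite /enc_node /= -!catA !catrev_catl.
have e h' v g' := @exec_field [::] inp h' v g' f o r isT.
apply: exec_le; first exact: exec_then (e _ _ _) (exec_then (e _ _ _) (e _ _ _)).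
by rewrite !size_cat !size_rcons !size_nseq /=; lia.
Qed.

(** The memory is poured onto the scratch stack, so that node 0 comes first, and goes back field by
    field. The fields are added to registers 3 to 5, which callers must have cleared. *)
Definition fetch : prog :=
  Seq (pour 1 2) (Seq (While (reg 6) is_one (Seq (Pop (reg 6)) skip_node))
    (Seq (field [:: 3]) (Seq (field [:: 4]) (Seq (field [:: 5]) (pour 2 1))))).

Lemma exec_skip_nodes inp h pre g f o r :
  nth 0 r 6 = size pre ->
  exec (While (reg 6) is_one (Seq (Pop (reg 6)) skip_node))
    (cfg inp h (enc pre ++ g) f o r)
    (6 * size (enc pre) + 1) (cfg inp (catrev (enc pre) h) g f o (set_nth 0 r 6 0)).
Proof.
elim: pre h r => [|x pre IH] h r r6 /=.
  have <- : cfg inp h g f o r = cfg inp h g f o (set_nth 0 r 6 0).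
    rewrite -(upd_cfg_reg _ _ _ _ _ _ 6 0); apply: functional_extensionality => i.
    by rewrite /upd; case: eqP => // ->; rewrite cfg_reg r6.
  by apply: exec_while_false; rewrite ?cfg_reg ?r6.
have -> : set_nth 0 r 6 0 = set_nth 0 (set_nth 0 r 6 (size pre)) 6 0 by rewrite set_set_nth eqxx.
have {}IH := IH (catrev (enc_node x) h) (set_nth 0 r 6 (size pre)).
rewrite nth_set_nth /= in IH.
rewrite {1 3}/enc /= -catA catrev_catl -/(enc pre).
apply: exec_while_true (IH erefl) _.
- by rewrite cfg_reg r6.
- apply: exec_then (exec_skip_node _ _ _ _ _ _ _).
  rewrite -upd_cfg_reg; apply: (exec_pop (b := true) (n := 1)) => //.
  by rewrite cfg_reg r6.
- rewrite /enc /= size_cat /enc_node !size_cat !size_rcons; lia.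
Qed.

Lemma enc_cat heap heap' : enc (heap ++ heap') = enc heap ++ enc heap'.
Proof. by rewrite /enc map_cat flatten_cat. Qed.

Lemma rev_cat_catrev (T : Type) (s t : seq T) : rev (s ++ t) = catrev t (rev s).
Proof. by rewrite rev_cat catrevE. Qed.

Lemma exec_fetch inp heap f o r x : node_at heap (nth 0 r 6) x ->
  exec fetch (cfg inp (rev (enc heap)) [::] f o r) (30 * size (enc heap) + 30)
    (cfg inp (rev (enc heap)) [::] f o
       (add_reg x.2 5 (add_reg x.1.2 4 (add_reg x.1.1 3 (set_nth 0 r 6 0))))).
Proof.
case=> lt nx; set pre := take (nth 0 r 6) heap; set suf := drop (nth 0 r 6).+1 heap.
have szpre : size pre = nth 0 r 6 by rewrite size_take lt.
have Eh : heap = pre ++ x :: suf by rewrite -nx -drop_nth // cat_take_drop.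
have Ee : enc heap = enc pre ++ enc_field x.1.1 ++ enc_field x.1.2 ++ enc_field x.2 ++ enc suf.
  by rewrite {1}Eh enc_cat /enc /= /enc_node -!catA.
have e1 : exec (pour 1 2) (cfg inp (rev (enc heap)) [::] f o r) (5 * size (enc heap) + 1)
    (cfg inp [::] (enc heap) f o r).
  have := @exec_pour 1 2 (cfg inp (rev (enc heap)) [::] f o r) isT.
  by rewrite upd_cfg1 upd_cfg2 /= catrevE revK cats0 size_rev.
set h := catrev (enc_field x.2) (catrev (enc_field x.1.2) (catrev (enc_field x.1.1)
           (catrev (enc pre) [::]))).
set r' := add_reg _ _ _.
have e2 : exec (pour 2 1) (cfg inp h (enc suf) f o r') (5 * size (enc suf) + 1)
    (cfg inp (rev (enc heap)) [::] f o r').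
  have := @exec_pour 2 1 (cfg inp h (enc suf) f o r') isT.
  by rewrite upd_cfg2 upd_cfg1 /= Ee rev_cat_catrev !catrev_catl.
rewrite Ee in e1; rewrite {1}Ee; apply: exec_le.
  have e h' v g' r0 j := @exec_field [:: j] inp h' v g' f o r0 isT.
  exact: exec_then e1 (exec_then (exec_skip_nodes _ _ _ _ _ (esym szpre))
           (exec_then (e _ _ _ _ _) (exec_then (e _ _ _ _ _) (exec_then (e _ _ _ _ _) e2)))).
by rewrite Ee !size_cat /enc_field !size_rcons !size_nseq /=; lia.
Qed.

Definition store (i : nat) (js : seq nat) : prog :=
  Seq (move_ones (reg i) (1 :: map reg js)) (Push 1 false).

Lemma exec_store i js inp h g f o r : i \notin js -> uniq js ->
  exec (store i js) (cfg inp h g f o r) (nth 0 r i * (2 * size js + 5) + 3)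
    (cfg inp (catrev (enc_field (nth 0 r i)) h) g f o
       (foldr (add_reg (nth 0 r i)) (set_nth 0 r i 0) js)).
Proof.
move=> ijs ujs; rewrite catrevE rev_rcons rev_nseq.
apply: exec_seq (exec_store_move _ _ _ _ _ _ ijs ujs) (exec_push_mem _ _ _ _ _ _ _) _.
by rewrite -addnA.
Qed.

Lemma exec_inc j inp h g f o r :
  exec (Push (reg j) true) (cfg inp h g f o r) 2
    (cfg inp h g f o (set_nth 0 r j (nth 0 r j).+1)).
Proof.
have := @exec_push (reg j) true (cfg inp h g f o r) 2 isT.
by rewrite cfg_reg (upd_cfg_reg _ _ _ _ _ _ _ (nth 0 r j).+1).
Qed.

(** A nonzero tag is decremented, so nested tests decode it and leave register 3 at zero in the
    selected branch. *)
Definition ifz (p q : prog) : prog := If (reg 3) is_empty p (Seq (Pop (reg 3)) q).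

Lemma exec_ifz0 p q inp h g f o r n m : nth 0 r 3 = 0 ->
  exec p (cfg inp h g f o r) n m -> exec (ifz p q) (cfg inp h g f o r) n.+1 m.
Proof. by move=> r3 e; apply: exec_if_true e _ => //; rewrite cfg_reg r3. Qed.

Lemma exec_ifzS p q inp h g f o r n m v : nth 0 r 3 = v.+1 ->
  exec q (cfg inp h g f o (set_nth 0 r 3 v)) n m ->
  exec (ifz p q) (cfg inp h g f o r) n.+2 m.
Proof.
move=> r3 e; apply: exec_if_false; first by rewrite cfg_reg r3.
  apply: exec_then e; rewrite -upd_cfg_reg.
  by apply: (exec_pop (b := true) (n := 1)); rewrite ?cfg_reg ?r3.
by [].
Qed.

Definition mv (i j : nat) : prog := move_ones (reg i) (map reg [:: j]).
Definition clr (i : nat) : prog := move_ones (reg i) (map reg [::]).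
Definition push_ones (i n : nat) : prog := iter n (Seq (Push i true)) Skip.

Lemma exec_push_ones j n inp h g f o r :
  exec (push_ones (reg j) n) (cfg inp h g f o r) (2 * n + 1)
    (cfg inp h g f o (add_reg n j r)).
Proof.
rewrite /add_reg; elim: n r => [|n IH] r.
  have -> : cfg inp h g f o (set_nth 0 r j (nth 0 r j + 0)) = cfg inp h g f o r.
    rewrite -upd_cfg_reg addn0; apply: functional_extensionality => i.
    by rewrite /upd; case: eqP => // ->; rewrite cfg_reg.
  exact: exec_skip.
have := IH (set_nth 0 r j (nth 0 r j).+1).
rewrite set_set_nth nth_set_nth /= eqxx addSnnS => e.
by apply: exec_seq (exec_inc _ _ _ _ _ _ _) e _; rewrite mulnS.
Qed.

(* Register 0 holds the code pointer, 1 the environment, 2 the stack, 6 the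
   address given to [fetch], 3 to 5 the fields read, 7 the size of the memory.
   The tag in the first field of a code node is 0 for [Var 0], 1 for a successor
   index, 2 for [Lam], 3 for [App] and [4 + i] for [Cst i]. Environments and stacks
   are lists of nodes (code, environment, next). *)
Definition step_var0 : prog :=
  Seq (clr 4) (Seq (clr 5) (Seq (mv 1 6) (Seq fetch
    (Seq (mv 3 0) (Seq (mv 4 1) (clr 5)))))).
Definition step_varS : prog :=
  Seq (mv 4 0) (Seq (clr 5) (Seq (mv 1 6) (Seq fetch
    (Seq (clr 3) (Seq (clr 4) (mv 5 1)))))).
Definition step_lam : prog :=
  Seq (mv 4 0) (Seq (clr 5) (Seq (mv 2 6) (Seq fetch
    (Seq (store 3 [::]) (Seq (store 4 [::]) (Seq (store 1 [::])
    (Seq (mv 5 2) (Seq (move_ones (reg 7) (map reg [:: 1; 8])) (Seq (mv 8 7)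
    (Push (reg 7) true)))))))))).
Definition step_app : prog :=
  Seq (mv 4 0) (Seq (store 5 [::]) (Seq (store 1 [:: 8]) (Seq (mv 8 1)
    (Seq (store 2 [::]) (Seq (move_ones (reg 7) (map reg [:: 2; 8])) (Seq (mv 8 7)
    (Push (reg 7) true))))))).
(* Node 8 is the stack of the three constants. *)
Definition step_out (b : bool) : prog :=
  Seq (clr 1) (Seq (clr 4) (Seq (clr 5) (Seq (mv 2 6) (Seq fetch
    (Seq (mv 3 0) (Seq (mv 4 1) (Seq (clr 5) (Seq (push_ones (reg 2) 8) (Push 4 b))))))))).

(** Tags are tried in increasing order: 4 and 5 emit a letter and restart on the tail, 6 marks the
    end of the word and clears the run flag. *)
Definition step : prog :=
  Seq (mv 0 6) (Seq fetch (ifz step_var0 (ifz step_varS (ifz step_lam (ifz step_app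
    (ifz (step_out false) (ifz (step_out true) (Pop 3)))))))).

Definition conf (heap : seq node) (c e s : nat) (o : seq bool) : stacks :=
  cfg [::] (rev (enc heap)) [::] [:: true] o [:: c; e; s; 0; 0; 0; 0; size heap; 0].

(** At most two fetches and a bounded number of register transfers, each linear in these sizes; 200
    leaves room. *)
Definition step_cost (heap : seq node) (c e s : nat) : nat :=
  200 * (size (enc heap) + c + e + s + size heap + 1).

Lemma node_at_size heap p x : node_at heap p x -> x.1.1 + x.1.2 + x.2 <= size (enc heap).
Proof.
case=> lt nx.
have -> : heap = take p heap ++ x :: drop p.+1 heap.
  by rewrite -nx -drop_nth // cat_take_drop.
by rewrite enc_cat /enc /= /enc_node !size_cat !size_rcons !size_nseq; lia.
Qed.

Lemma enc_rcons heap a b c :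
  catrev (enc_field c) (catrev (enc_field b) (catrev (enc_field a) (rev (enc heap)))) =
  rev (enc (rcons heap (a, b, c))).
Proof. by rewrite -cats1 enc_cat rev_cat_catrev /enc /= cats0 /enc_node /= !catrev_catl. Qed.

(* Running times accumulate in an existential variable, compared with the announced bound only at
   the end of each proof by [exec_le]. *)
Tactic Notation "run" uconstr(lem) :=
  eapply exec_then; [refine lem | rewrite /add_reg /= ?add0n].

Lemma exec_step_app heap c e s o a b : node_at heap c (3, a, b) ->
  exec step (conf heap c e s o) (step_cost heap c e s)
    (conf (rcons heap (b, e, s)) a e (size heap) o).
Proof.
move=> at_c; have := node_at_size at_c; rewrite /= => le.
apply: exec_le.
  rewrite /step /conf.
  run (@exec_move 0 [:: 6] _ _ _ _ _ _ isT isT).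
  run (@exec_fetch [::] heap [:: true] o [:: 0; e; s; 0; 0; 0; c; size heap; 0] _ at_c).
  do 3 apply: exec_ifzS => //=.
  apply: exec_ifz0 => //=.
  run (@exec_move 4 [:: 0] _ _ _ _ _ _ isT isT).
  run (@exec_store 5 [::] _ _ _ _ _ _ isT isT).
  run (@exec_store 1 [:: 8] _ _ _ _ _ _ isT isT).
  run (@exec_move 8 [:: 1] _ _ _ _ _ _ isT isT).
  run (@exec_store 2 [::] _ _ _ _ _ _ isT isT).
  run (@exec_move 7 [:: 2; 8] _ _ _ _ _ _ isT isT).
  run (@exec_move 8 [:: 7] _ _ _ _ _ _ isT isT).
  by rewrite enc_rcons size_rcons; apply: exec_inc.
by rewrite /step_cost /=; lia.
Qed.

Lemma exec_step_lam heap c e s o a z x : node_at heap c (2, a, z) -> node_at heap s x ->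
  exec step (conf heap c e s o) (step_cost heap c e s)
    (conf (rcons heap (x.1.1, x.1.2, e)) a (size heap) x.2 o).
Proof.
move=> at_c at_s; have := node_at_size at_c; have := node_at_size at_s; rewrite /= => le le'.
apply: exec_le.
  rewrite /step /conf.
  run (@exec_move 0 [:: 6] _ _ _ _ _ _ isT isT).
  run (@exec_fetch [::] heap [:: true] o [:: 0; e; s; 0; 0; 0; c; size heap; 0] _ at_c).
  do 2 apply: exec_ifzS => //=.
  apply: exec_ifz0 => //=.
  run (@exec_move 4 [:: 0] _ _ _ _ _ _ isT isT).
  run (@exec_move 5 [::] _ _ _ _ _ _ isT isT).
  run (@exec_move 2 [:: 6] _ _ _ _ _ _ isT isT).
  run (@exec_fetch [::] heap [:: true] o [:: a; e; 0; 0; 0; 0; s; size heap; 0] _ at_s).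
  run (@exec_store 3 [::] _ _ _ _ _ _ isT isT).
  run (@exec_store 4 [::] _ _ _ _ _ _ isT isT).
  run (@exec_store 1 [::] _ _ _ _ _ _ isT isT).
  run (@exec_move 5 [:: 2] _ _ _ _ _ _ isT isT).
  run (@exec_move 7 [:: 1; 8] _ _ _ _ _ _ isT isT).
  run (@exec_move 8 [:: 7] _ _ _ _ _ _ isT isT).
  by rewrite enc_rcons size_rcons; apply: exec_inc.
by rewrite /step_cost /=; lia.
Qed.

Lemma exec_step_var0 heap c e s o y z x : node_at heap c (0, y, z) -> node_at heap e x ->
  exec step (conf heap c e s o) (step_cost heap c e s) (conf heap x.1.1 x.1.2 s o).
Proof.
move=> at_c at_e; have := node_at_size at_c; have := node_at_size at_e; rewrite /= => le le'.
apply: exec_le.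
  rewrite /step /conf.
  run (@exec_move 0 [:: 6] _ _ _ _ _ _ isT isT).
  run (@exec_fetch [::] heap [:: true] o [:: 0; e; s; 0; 0; 0; c; size heap; 0] _ at_c).
  apply: exec_ifz0 => //=.
  run (@exec_move 4 [::] _ _ _ _ _ _ isT isT).
  run (@exec_move 5 [::] _ _ _ _ _ _ isT isT).
  run (@exec_move 1 [:: 6] _ _ _ _ _ _ isT isT).
  run (@exec_fetch [::] heap [:: true] o [:: 0; 0; s; 0; 0; 0; e; size heap; 0] _ at_e).
  run (@exec_move 3 [:: 0] _ _ _ _ _ _ isT isT).
  run (@exec_move 4 [:: 1] _ _ _ _ _ _ isT isT).
  exact: (@exec_move 5 [::] _ _ _ _ _ _ isT isT).
by rewrite /step_cost /=; lia.
Qed.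

Lemma exec_step_varS heap c e s o a z x : node_at heap c (1, a, z) -> node_at heap e x ->
  exec step (conf heap c e s o) (step_cost heap c e s) (conf heap a x.2 s o).
Proof.
move=> at_c at_e; have := node_at_size at_c; have := node_at_size at_e; rewrite /= => le le'.
apply: exec_le.
  rewrite /step /conf.
  run (@exec_move 0 [:: 6] _ _ _ _ _ _ isT isT).
  run (@exec_fetch [::] heap [:: true] o [:: 0; e; s; 0; 0; 0; c; size heap; 0] _ at_c).
  apply: exec_ifzS => //=.
  apply: exec_ifz0 => //=.
  run (@exec_move 4 [:: 0] _ _ _ _ _ _ isT isT).
  run (@exec_move 5 [::] _ _ _ _ _ _ isT isT).
  run (@exec_move 1 [:: 6] _ _ _ _ _ _ isT isT).
  run (@exec_fetch [::] heap [:: true] o [:: a; 0; s; 0; 0; 0; e; size heap; 0] _ at_e).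
  run (@exec_move 3 [::] _ _ _ _ _ _ isT isT).
  run (@exec_move 4 [::] _ _ _ _ _ _ isT isT).
  exact: (@exec_move 5 [:: 1] _ _ _ _ _ _ isT isT).
by rewrite /step_cost /=; lia.
Qed.

Lemma exec_out b heap e s o y z x n : node_at heap s x -> n = size heap ->
  exec (step_out b)
    (cfg [::] (rev (enc heap)) [::] [:: true] o [:: 0; e; s; 0; y; z; 0; n; 0])
    (5 * (e + s + y + z) + 60 * size (enc heap) + 100) (conf heap x.1.1 x.1.2 8 (b :: o)).
Proof.
move=> at_s ->; have := node_at_size at_s => le.
apply: exec_le.
  run (@exec_move 1 [::] _ _ _ _ _ _ isT isT).
  run (@exec_move 4 [::] _ _ _ _ _ _ isT isT).
  run (@exec_move 5 [::] _ _ _ _ _ _ isT isT).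
  run (@exec_move 2 [:: 6] _ _ _ _ _ _ isT isT).
  run (@exec_fetch [::] heap [:: true] o [:: 0; 0; 0; 0; 0; 0; s; size heap; 0] _ at_s).
  run (@exec_move 3 [:: 0] _ _ _ _ _ _ isT isT).
  run (@exec_move 4 [:: 1] _ _ _ _ _ _ isT isT).
  run (@exec_move 5 [::] _ _ _ _ _ _ isT isT).
  run (@exec_push_ones 2 8 _ _ _ _ _ _).
  have := @exec_push 4 b (cfg [::] (rev (enc heap)) [::] [:: true] o
    [:: x.1.1; x.1.2; 8; 0; 0; 0; 0; size heap; 0]) 2 isT.
  by rewrite upd_cfg4; apply.
by rewrite /=; lia.
Qed.

Lemma exec_step_out heap c e s o (b : bool) y z x :
  node_at heap c (4 + b, y, z) -> node_at heap s x ->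
  exec step (conf heap c e s o) (step_cost heap c e s) (conf heap x.1.1 x.1.2 8 (b :: o)).
Proof.
move=> at_c at_s; have := node_at_size at_c; have := node_at_size at_s; rewrite /= => le.
case: b at_c => at_c le'; (apply: exec_le; [rewrite /step /conf;
  run (@exec_move 0 [:: 6] _ _ _ _ _ _ isT isT);
  run (@exec_fetch [::] heap [:: true] o [:: 0; e; s; 0; 0; 0; c; size heap; 0] _ at_c);
  do 4 (apply: exec_ifzS => //=)|]).
- apply: exec_ifzS => //=; apply: exec_ifz0 => //=.
  exact: (exec_out true e o y z at_s erefl).
- by rewrite /step_cost /=; lia.
- apply: exec_ifz0 => //=.
  exact: (exec_out false e o y z at_s erefl).
- by rewrite /step_cost /=; lia.
Qed.

Lemma exec_step_stop heap c e s o y z : node_at heap c (6, y, z) ->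
  exec step (conf heap c e s o) (step_cost heap c e s)
    (cfg [::] (rev (enc heap)) [::] [::] o [:: 0; e; s; 0; y; z; 0; size heap; 0]).
Proof.
move=> at_c; have := node_at_size at_c; rewrite /= => le.
apply: exec_le.
  rewrite /step /conf.
  run (@exec_move 0 [:: 6] _ _ _ _ _ _ isT isT).
  run (@exec_fetch [::] heap [:: true] o [:: 0; e; s; 0; 0; 0; c; size heap; 0] _ at_c).
  do 5 apply: exec_ifzS => //=.
  apply: exec_ifzS => //=.
  have := @exec_pop 3 true [::] (cfg [::] (rev (enc heap)) [::] [:: true] o
    [:: 0; e; s; 0; y; z; 0; size heap; 0]) 1 erefl isT.
  by rewrite upd_cfg3; apply.
by rewrite /step_cost /=; lia.
Qed.

(** * Simulation *)

Inductive rep_code (heap : seq node) : nat -> term -> Prop :=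
| rep_code_var0 p y z : node_at heap p (0, y, z) -> rep_code heap p (Var 0)
| rep_code_varS p i a z :
    node_at heap p (1, a, z) -> rep_code heap a (Var i) -> rep_code heap p (Var i.+1)
| rep_code_lam p t a z :
    node_at heap p (2, a, z) -> rep_code heap a t -> rep_code heap p (Lam t)
| rep_code_app p t u a b :
    node_at heap p (3, a, b) -> rep_code heap a t -> rep_code heap b u ->
    rep_code heap p (App t u).

(** The node of a constant does not mention [k], so it represents [Cst i k] for all triples at once.
    Any address represents the empty list: [rep_clos] describes only an initial segment of a chain
    of nodes. *)
Inductive rep_clo (heap : seq node) : nat -> nat -> clo -> Prop :=
| rep_clo_cst p e i k y z : node_at heap p (4 + i, y, z) -> rep_clo heap p e (Cst i k)
| rep_clo_clo p e t cs :
    rep_code heap p t -> rep_clos heap e cs -> rep_clo heap p e (Clo t cs)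
with rep_clos (heap : seq node) : nat -> seq clo -> Prop :=
| rep_clos_nil e : rep_clos heap e [::]
| rep_clos_cons e p e' n c cs :
    node_at heap e (p, e', n) -> rep_clo heap p e' c -> rep_clos heap n cs ->
    rep_clos heap e (c :: cs).

Scheme rep_clo_mind := Induction for rep_clo Sort Prop
with rep_clos_mind := Induction for rep_clos Sort Prop.
Combined Scheme rep_ind from rep_clo_mind, rep_clos_mind.

Lemma node_at_cat heap heap' p x : node_at heap p x -> node_at (heap ++ heap') p x.
Proof.
by case=> lt nx; split; rewrite ?size_cat ?ltn_addr // nth_cat lt.
Qed.

Lemma rep_code_cat heap heap' p t : rep_code heap p t -> rep_code (heap ++ heap') p t.
Proof.
elim=> {p t}.
- by move=> p y z H; apply: rep_code_var0 (node_at_cat _ H).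
- by move=> p i a z H _; apply: rep_code_varS (node_at_cat _ H).
- by move=> p t a z H _; apply: rep_code_lam (node_at_cat _ H).
- by move=> p t u a b H _ IHt _; apply: rep_code_app (node_at_cat _ H) IHt.
Qed.

Lemma rep_cat heap heap' :
  (forall p e c, rep_clo heap p e c -> rep_clo (heap ++ heap') p e c) /\
  (forall e cs, rep_clos heap e cs -> rep_clos (heap ++ heap') e cs).
Proof.
apply: rep_ind.
- by move=> p e i k y z H; apply: rep_clo_cst (node_at_cat _ H).
- by move=> p e t cs Ht _ IH; apply: rep_clo_clo => //; apply: rep_code_cat.
- by move=> e; apply: rep_clos_nil.
- by move=> e p e' n c cs H _ IHc _ IHcs; apply: rep_clos_cons (node_at_cat _ H) IHc IHcs.
Qed.

Lemma rep_clo_cat heap heap' p e c : rep_clo heap p e c -> rep_clo (heap ++ heap') p e c.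
Proof. exact: (rep_cat heap heap').1. Qed.

Lemma rep_clos_cat heap heap' e cs : rep_clos heap e cs -> rep_clos (heap ++ heap') e cs.
Proof. exact: (rep_cat heap heap').2. Qed.

Definition node_le (b : nat) (x : node) : bool :=
  [&& x.1.1 <= b, x.1.2 <= b & x.2 <= b].

(* The constant 6 accounts for the tags of code nodes. *)
Definition small (heap : seq node) (c e s : nat) : bool :=
  all (node_le (size heap + 6)) heap &&
  [&& c <= size heap + 6, e <= size heap + 6 & s <= size heap + 6].

Lemma node_le_trans b b' x : b <= b' -> node_le b x -> node_le b' x.
Proof.
by move=> le /and3P[h1 h2 h3]; apply/and3P; split; apply: leq_trans le.
Qed.

Lemma all_node_le_at b heap p x : all (node_le b) heap -> node_at heap p x -> node_le b x.
Proof. by move=> /all_nthP H [lt <-]; apply: H. Qed.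

Lemma size_enc b heap : all (node_le b) heap -> size (enc heap) <= size heap * (3 * b + 3).
Proof.
elim: heap => //= x heap IH /andP[/and3P[h1 h2 h3] /IH le].
rewrite /enc /= size_cat /enc_node !size_cat !size_rcons !size_nseq mulSn.
by apply: leq_add le; lia.
Qed.

(** At most [z] nodes with fields at most [z + 6] take [z * (3 * z + 21)] bits, so a quadratic bound
    on [step_cost] is enough. *)
Definition bound (z : nat) : nat := 2000 * (z + 7) ^ 2.

Lemma step_cost_bound heap c e s z :
  small heap c e s -> size heap <= z -> step_cost heap c e s <= bound z.
Proof.
case/andP=> /size_enc le /and3P[lc le' ls] lz.
rewrite /step_cost /bound; nia.
Qed.

Lemma small_rcons heap x c e s c' e' s' :
  small heap c e s -> node_le (size heap + 7) x ->
  [&& c' <= size heap + 7, e' <= size heap + 7 & s' <= size heap + 7] ->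
  small (rcons heap x) c' e' s'.
Proof.
case/andP=> H _ Hx Hr; rewrite /small size_rcons addSnnS Hr andbT.
rewrite all_rcons Hx /=; apply: sub_all H => y; apply: node_le_trans.
by rewrite leq_add2l.
Qed.

Definition rep (heap : seq node) (st : kstate) (c e s : nat) : Prop :=
  [/\ rep_clo heap c e st.1, rep_clos heap s st.2 & small heap c e s].

Lemma exec_kstep heap s1 s2 c e s o : kstep s1 s2 -> rep heap s1 c e s ->
  exists heap' c' e' s', [/\ rep (heap ++ heap') s2 c' e' s', size heap' <= 1 &
    exec step (conf heap c e s o) (step_cost heap c e s) (conf (heap ++ heap') c' e' s' o)].
Proof.
case=> {s1 s2} [t u cs st|t cs d st|d cs st|i d cs st] [/= Hc Hs sm];
  have [Hall /and3P[Sc Se Ss]] := andP sm.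
- inversion Hc as [|? ? ? ? Ht He]; subst.
  inversion Ht as [| | |? ? ? a b at_c Ha Hb]; subst.
  have /and3P[/= _ la lb] := all_node_le_at Hall at_c.
  exists [:: (b, e, s)], a, e, (size heap); rewrite cats1; split=> //.
    have sm' : small (rcons heap (b, e, s)) a e (size heap).
      by apply: small_rcons sm _ _; rewrite /node_le /=; apply/and3P; split; lia.
    rewrite -cats1 in sm' *; split=> //=.
      by apply: rep_clo_clo; [apply: rep_code_cat | apply: rep_clos_cat].
    apply: (rep_clos_cons (p := b) (e' := e) (n := s)).
    + by split; rewrite ?size_cat ?addn1 // nth_cat ltnn subnn.
    + by apply: rep_clo_clo; [apply: rep_code_cat | apply: rep_clos_cat].
    + exact: rep_clos_cat.
  exact: exec_step_app.
- inversion Hc as [|? ? ? ? Ht He]; subst.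
  inversion Ht as [| |? ? a z at_c Ha|]; subst.
  inversion Hs as [|? p e' n ? ? at_s Hd Hst]; subst.
  have /and3P[/= _ la _] := all_node_le_at Hall at_c.
  have /and3P[/= lp le' ln] := all_node_le_at Hall at_s.
  exists [:: (p, e', e)], a, (size heap), n; rewrite cats1; split=> //.
    have sm' : small (rcons heap (p, e', e)) a (size heap) n.
      by apply: small_rcons sm _ _; rewrite /node_le /=; apply/and3P; split; lia.
    rewrite -cats1 in sm' *; split=> //=; last exact: rep_clos_cat.
    apply: rep_clo_clo; first exact: rep_code_cat.
    apply: (rep_clos_cons (p := p) (e' := e') (n := e)).
    + by split; rewrite ?size_cat ?addn1 // nth_cat ltnn subnn.
    + exact: rep_clo_cat.
    + exact: rep_clos_cat.
  exact: (exec_step_lam e o at_c at_s).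
- inversion Hc as [|? ? ? ? Ht He]; subst.
  inversion Ht as [? y z at_c| | |]; subst.
  inversion He as [|? p e' n ? ? at_e Hd Hcs]; subst.
  have /and3P[/= lp le' _] := all_node_le_at Hall at_e.
  exists [::], p, e', s; rewrite cats0; split=> //.
    by split=> //=; rewrite /small Hall /=; apply/and3P.
  exact: (exec_step_var0 s o at_c at_e).
- inversion Hc as [|? ? ? ? Ht He]; subst.
  inversion Ht as [|? ? a z at_c Ha| |]; subst.
  inversion He as [|? p e' n ? ? at_e Hd Hcs]; subst.
  have /and3P[/= _ la _] := all_node_le_at Hall at_c.
  have /and3P[/= _ _ ln] := all_node_le_at Hall at_e.
  exists [::], a, n, s; rewrite cats0; split=> //.
    by split=> //=; [apply: rep_clo_clo | rewrite /small Hall /=; apply/and3P].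
  exact: (exec_step_varS s o at_c at_e).
Qed.

(** * The main loop and the output *)

Definition main : prog := While 3 is_one step.

Lemma exec_main heap c e s o n m n' m' :
  exec step (conf heap c e s o) n m -> exec main m n' m' ->
  exec main (conf heap c e s o) (n.+1 + n') m'.
Proof. by move=> e1 e2; apply: exec_while_true e1 e2 _. Qed.

(** [exec] describes only complete runs, so a partial run of the loop is expressed by transforming
    runs from the later configuration into runs from the earlier one. *)
Lemma exec_ksteps z j s1 s2 heap c e s o : ksteps j s1 s2 -> rep heap s1 c e s ->
  size heap + j <= z ->
  exists heap' c' e' s', [/\ rep (heap ++ heap') s2 c' e' s', size heap' <= j &
    forall n m, exec main (conf (heap ++ heap') c' e' s' o) n m ->
      exec main (conf heap c e s o) (j * (bound z).+1 + n) m].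
Proof.
move=> H; elim: H heap c e s => {j s1 s2} [s1|j s1 s2 s3 st _ IH] heap c e s R lez.
  by exists [::], c, e, s; rewrite cats0.
have [h1 [c1 [e1 [p1 [R1 sz1 X1]]]]] := exec_kstep o st R.
have [|h2 [c2 [e2 [p2 [R2 sz2 X2]]]]] := IH _ _ _ _ R1.
  by rewrite size_cat; lia.
exists (h1 ++ h2), c2, e2, p2; rewrite catA; split=> //.
  by rewrite size_cat; lia.
move=> n m /X2/(exec_main X1) X; apply: exec_le X _.
have [_ _ sm] := R.
by rewrite mulSn -addnA leq_add2r ltnS; apply: step_cost_bound sm _; lia.
Qed.

(** Nodes 0 to 2 are the codes of [Var 0], [Var 1], [Var 2]; nodes 3 to 5 those of the constants;
    nodes 6 to 8 the stack of constants, with its top at 8. *)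
Definition base : seq node :=
  [:: (0, 0, 0); (1, 0, 0); (1, 1, 0); (4, 0, 0); (5, 0, 0); (6, 0, 0);
      (5, 0, 0); (4, 0, 6); (3, 0, 7)].

Definition consts (k : nat) : seq clo := [:: Cst 0 k; Cst 1 k; Cst 2 k].

Lemma rep_consts heap k : rep_clos (base ++ heap) 8 (consts k).
Proof.
apply: rep_clos_cat; apply: (@rep_clos_cons _ 8 3 0 7) => //.
  by apply: (@rep_clo_cst _ _ _ _ _ 0 0).
apply: (@rep_clos_cons _ 7 4 0 6) => //.
  by apply: (@rep_clo_cst _ _ _ _ _ 0 0).
apply: (@rep_clos_cons _ 6 5 0 0) => //.
  by apply: (@rep_clo_cst _ _ _ _ _ 0 0).
exact: rep_clos_nil.
Qed.

Lemma probeE s k : probe s k = (s.1, s.2 ++ consts k).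
Proof. by rewrite /probe /sapp /= -!cats1 -!catA. Qed.

(** The stack must be represented for every [k] because [reads] chooses the triple. Besides the [m]
    transitions there is one round per letter and one to stop, each with its loop test; the last 1
    is the failing test. Stack 14 lies beyond the registers in use and stays empty to receive the
    result. *)
Lemma exec_reads z st m w heap c e s o : reads st m w ->
  rep_clo (base ++ heap) c e st.1 ->
  (forall k, rep_clos (base ++ heap) s (st.2 ++ consts k)) ->
  small (base ++ heap) c e s -> size (base ++ heap) + m <= z ->
  exists2 m', exec main (conf (base ++ heap) c e s o)
                ((m + (size w).+1) * (bound z).+1 + 1) m' &
    m' 4 = catrev w o /\ m' 14 = [::].
Proof.
move=> H; elim: H heap c e s o => {st m w}.
  move=> st k m m' run le heap c e s o Hc Hs sm lez.
  have R : rep (base ++ heap) (probe st k) c e s by rewrite probeE; split=> //=; apply: Hs.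
  have [|h1 [c1 [e1 [s1 [[R1 _ sm1] sz1 X]]]]] := exec_ksteps (z := z) o run R.
    by lia.
  have {}R1 : rep_clo _ c1 e1 (Cst 2 k) := R1.
  inversion R1 as [? ? ? ? y v at_c|]; subst.
  have e1' := exec_step_stop e1 s1 o at_c.
  eexists; first apply: exec_le.
  - apply: X; apply: exec_main e1' _.
    by apply: (@exec_while_false _ _ _ _ 1).
  - have := step_cost_bound sm1 (z := z); rewrite !size_cat => le1.
    have {}le1 := le1 ltac:(rewrite size_cat in lez; lia).
    by rewrite mulnDl; nia.
  - by [].
move=> st k b d w m1 m2 m run rd IH le heap c e s o Hc Hs sm lez.
have R : rep (base ++ heap) (probe st k) c e s by rewrite probeE; split=> //=; apply: Hs.
have [|h1 [c1 [e1 [s1 [[R1 R2 sm1] sz1 X]]]]] := exec_ksteps (z := z) o run R.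
  by lia.
have {}R1 : rep_clo _ c1 e1 (Cst b k) := R1.
have {}R2 : rep_clos _ s1 [:: d] := R2.
inversion R1 as [? ? ? ? y v at_c|]; subst.
inversion R2 as [|? p e' n ? ? at_s Hd _]; subst.
have eo := exec_step_out e1 o at_c at_s.
have [Hall _] := andP sm1.
have /and3P[/= lp le' _] := all_node_le_at Hall at_s.
rewrite -catA in at_c at_s Hd eo X sm1 Hall lp le'.
have [||||m' X' [m4 m14]] := IH (heap ++ h1) p e' 8 (b :: o).
- exact: Hd.
- by move=> k'; apply: rep_consts.
- by rewrite /small Hall lp le' /= addnC.
- by move: lez; rewrite !size_cat; lia.
exists m'; last by split.
apply: exec_le; first by apply: X; apply: exec_main eo X'.
have := step_cost_bound sm1 (z := z); rewrite !size_cat => le1.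
have {}le1 := le1 ltac:(rewrite size_cat in lez; lia).
set K := step_cost _ _ _ _ in le1 *.
have leB : (m1 + m2) * (bound z).+1 <= m * (bound z).+1 by rewrite leq_mul2r le orbT.
move: K (bound z) le1 leB => K B le1; rewrite /= !mulnDl => leB.
by rewrite !mulSn; lia.
Qed.

(** A probe has at least three closures on its stack and a letter answer only one, so each letter
    takes at least one transition. This makes the output rounds polynomially many. *)
Lemma reads_size st m w : reads st m w -> size w <= m.
Proof.
elim=> {st m w} // st k b d w m1 m2 m run _ IH le.
suff : 0 < m1 by rewrite /=; lia.
case: m1 run {le} => // run.
have E : probe st k = (Cst b k, [:: d]).
  by move: run; move E0: 0 => n run; case: run E0.
by move/(congr1 (fun s => size s.2)): E; rewrite probeE /= size_cat /= addnC.
Qed.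

(** * Initial memory *)

Definition good (heap : seq node) : Prop :=
  node_at heap 0 (0, 0, 0) /\ all (node_le (size heap + 6)) heap.

Lemma good_rcons heap x : good heap -> node_le (size heap + 7) x -> good (rcons heap x).
Proof.
case=> H0 H Hx; split; first by rewrite -cats1; apply: node_at_cat.
rewrite size_rcons addSnnS all_rcons Hx /=; apply: sub_all H => y.
by apply: node_le_trans; rewrite leq_add2l.
Qed.

Lemma node_at_last heap x : node_at (rcons heap x) (size heap) x.
Proof. by split; rewrite ?size_rcons // nth_rcons ltnn eqxx. Qed.

Lemma rep_code_exists t heap : good heap -> exists tn p,
  [/\ good (heap ++ tn), p < size (heap ++ tn) & rep_code (heap ++ tn) p t].
Proof.
elim: t heap => [i|t IH|t IHt u IHu] heap G.
- elim: i => [|i [tn [p [G1 lt Hp]]]].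
    exists [::], 0; rewrite cats0; split=> //; first by case: G => -[].
    by case: G => H0 _; apply: rep_code_var0 H0.
  exists (rcons tn (1, p, 0)), (size (heap ++ tn)); rewrite -rcons_cat; split.
  + by apply: good_rcons => //; rewrite /node_le /=; apply/and3P; split; lia.
  + by rewrite size_rcons.
  + apply: rep_code_varS (node_at_last _ _) _.
    by rewrite -cats1; apply: rep_code_cat.
- have [tn [p [G1 lt Hp]]] := IH heap G.
  exists (rcons tn (2, p, 0)), (size (heap ++ tn)); rewrite -rcons_cat; split.
  + by apply: good_rcons => //; rewrite /node_le /=; apply/and3P; split; lia.
  + by rewrite size_rcons.
  + apply: rep_code_lam (node_at_last _ _) _.
    by rewrite -cats1; apply: rep_code_cat.
- have [tn [p [G1 lt Hp]]] := IHt heap G.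
  have [un [p' [G2 lt' Hp']]] := IHu (heap ++ tn) G1.
  exists (rcons (tn ++ un) (3, p, p')), (size (heap ++ tn ++ un)).
  rewrite -rcons_cat catA; split.
  + apply: good_rcons => //; rewrite /node_le /=; apply/and3P; split; try lia.
    by rewrite size_cat; lia.
  + by rewrite size_rcons.
  + apply: rep_code_app (node_at_last _ _) _ _; rewrite -cats1; apply: rep_code_cat => //.
    exact: rep_code_cat.
Qed.

(** Addresses in [base] of [Var 1] and [Var 2]. *)
Definition letter_code (b : bool) : nat := if b then 1 else 2.

(** The input is consumed from left to right, so each application points forward to a node not yet
    written; the chain ends at the [Var 0] node appended by [init_heap]. *)
Fixpoint letters (q : nat) (w : word) : seq node :=
  if w is b :: w' then (3, letter_code b, q.+1) :: letters q.+1 w' else [::].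

Lemma size_letters q w : size (letters q w) = size w.
Proof. by elim: w q => //= b w IH q; rewrite IH. Qed.

Lemma good_letters heap w : good heap -> good (heap ++ letters (size heap) w).
Proof.
elim: w heap => [|b w IH] heap G /=; first by rewrite cats0.
have := IH (rcons heap (3, letter_code b, (size heap).+1)).
rewrite size_rcons cat_rcons; apply; apply: good_rcons => //.
by rewrite /node_le /= /letter_code; apply/and3P; split; case: b; lia.
Qed.

Lemma rep_letters heap w : (forall b, rep_code heap (letter_code b) (letter b)) ->
  rep_code (rcons (heap ++ letters (size heap) w) (0, 0, 0)) (size heap)
    (foldr (fun b u => App (letter b) u) (Var 0) w).
Proof.
elim: w heap => [|b w IH] heap H /=.
  by rewrite cats0; apply: rep_code_var0 (node_at_last _ _).
set x := (3, letter_code b, (size heap).+1).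
have H' b' : rep_code (rcons heap x) (letter_code b') (letter b').
  by rewrite -cats1; apply/rep_code_cat/H.
have := IH _ H'; rewrite size_rcons cat_rcons => body.
have at_x s : node_at (rcons (heap ++ x :: s) (0, 0, 0)) (size heap) x.
  by rewrite -cat_rcons -cats1 -catA; apply/node_at_cat/node_at_last.
apply: rep_code_app (at_x _) _ body.
by rewrite -cats1 -catA; apply: rep_code_cat.
Qed.

Definition push_bits (s : seq bool) : prog := foldr (fun b p => Seq (Push 1 b) p) Skip s.

Lemma exec_push_bits s inp h g f o r :
  exec (push_bits s) (cfg inp h g f o r) (2 * size s + 1) (cfg inp (catrev s h) g f o r).
Proof.
elim: s h => [|b s IH] h /=; first exact: exec_skip.
by apply: exec_seq (exec_push_mem _ _ _ _ _ _ _) (IH _) _; rewrite mulnS.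
Qed.

(** The pointer to the next node is register 7 plus one: [[:: true; false]] supplies the extra one
    and the terminator. *)
Definition emit (b : bool) : prog :=
  Seq (push_bits (enc_field 3 ++ enc_field (letter_code b)))
    (Seq (move_ones (reg 7) (1 :: map reg [:: 8])) (Seq (push_bits [:: true; false])
    (Seq (mv 8 7) (Push (reg 7) true)))).

Definition idle_regs (n : nat) : seq nat := [:: 0; 0; 0; 0; 0; 0; 0; n; 0].

Lemma exec_emit b inp heap g f o :
  exec (emit b) (cfg inp (rev (enc heap)) g f o (idle_regs (size heap)))
    (12 * size heap + 30)
    (cfg inp (rev (enc (rcons heap (3, letter_code b, (size heap).+1)))) g f o
       (idle_regs (size heap).+1)).
Proof.
apply: exec_le.
  run (exec_push_bits _ _ _ _ _ _ _).
  run (@exec_store_move 7 [:: 8] _ _ _ _ _ _ isT isT).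
  run (exec_push_bits [:: true; false] _ _ _ _ _ _).
  run (@exec_move 8 [:: 7] _ _ _ _ _ _ isT isT).
  have -> : rev (enc (rcons heap (3, letter_code b, (size heap).+1))) =
      [:: false, true & nseq (size heap) true ++
         catrev (enc_field 3 ++ enc_field (letter_code b)) (rev (enc heap))].
    rewrite -enc_rcons catrev_catl [catrev (enc_field (size heap).+1) _]catrevE.
    by rewrite rev_rcons rev_nseq.
  exact: exec_inc.
by rewrite size_cat !size_rcons !size_nseq /letter_code /=; case: (b); lia.
Qed.

Definition emit_letters : prog :=
  While 0 isSome (If 0 is_one (Seq (Pop 0) (emit true)) (Seq (Pop 0) (emit false))).

Lemma exec_emit_letters w heap g f o :
  exec emit_letters (cfg w (rev (enc heap)) g f o (idle_regs (size heap)))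
    (size w * (12 * (size heap + size w) + 40) + 1)
    (cfg [::] (rev (enc (heap ++ letters (size heap) w))) g f o
       (idle_regs (size heap + size w))).
Proof.
elim: w heap => [|b w IH] heap /=.
  by rewrite cats0 addn0; apply: exec_while_false.
have := IH (rcons heap (3, letter_code b, (size heap).+1)).
rewrite size_rcons cat_rcons addSnnS => e.
have pop : exec (Pop 0) (cfg (b :: w) (rev (enc heap)) g f o (idle_regs (size heap))) 1
    (cfg w (rev (enc heap)) g f o (idle_regs (size heap))).
  have := @exec_pop 0 b w (cfg (b :: w) (rev (enc heap)) g f o (idle_regs (size heap)))
            1 erefl isT.
  by rewrite upd_cfg0.
apply: (@exec_while_true _ _ _ _ _ _ (12 * size heap + 32) _ _ _ _ e) => //.
  case: b pop {e} => pop.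
    by apply: exec_if_true (exec_then pop (exec_emit _ _ _ _ _ _)) _ => //; lia.
  by apply: exec_if_false (exec_then pop (exec_emit _ _ _ _ _ _)) _ => //; lia.
by rewrite mulSn; nia.
Qed.

(** Node [q] is the initial stack cell, holding the Church word on top of the constants; three
    abstractions follow, the last pointing to the address where the letters begin. *)
Definition church_heap (q : nat) : seq node :=
  [:: (q.+1, 0, 8); (2, q.+2, 0); (2, q.+3, 0); (2, q.+4, 0)].

Section Machine.

Variables (heap1 : seq node) (pt q : nat).

Definition init_prog : prog :=
  Seq (push_bits (enc heap1)) (Seq (push_ones (reg 7) (size heap1)) (Seq emit_letters
    (Seq (push_bits (enc_node (0, 0, 0))) (Seq (Push (reg 7) true)
    (Seq (push_ones (reg 0) pt) (Seq (push_ones (reg 2) q) (Push 3 true))))))).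

Definition init_heap (w : word) : seq node :=
  rcons (heap1 ++ letters (size heap1) w) (0, 0, 0).

Lemma size_init_heap w : size (init_heap w) = (size heap1 + size w).+1.
Proof. by rewrite /init_heap size_rcons size_cat size_letters. Qed.

Lemma init_stacksE w : init_stacks w = cfg w [::] [::] [::] [::] (idle_regs 0).
Proof.
apply: functional_extensionality; do 14 case=> //; move=> i.
by rewrite /cfg /= nth_nil.
Qed.

Lemma exec_init w :
  exec init_prog (init_stacks w)
    (2 * size (enc heap1) + 2 * size heap1 + 2 * pt + 2 * q + 20 +
     size w * (12 * (size heap1 + size w) + 40))
    (conf (init_heap w) pt 0 q [::]).
Proof.
rewrite init_stacksE; apply: exec_le.
  run (exec_push_bits _ _ _ _ _ _ _).
  run (exec_push_ones 7 _ _ _ _ _ _ _).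
  run (exec_emit_letters w heap1 _ _ _).
  run (exec_push_bits (enc_node (0, 0, 0)) _ _ _ _ _ _).
  run (exec_inc 7 _ _ _ _ _ _).
  run (exec_push_ones 0 _ _ _ _ _ _ _).
  run (exec_push_ones 2 _ _ _ _ _ _ _).
  have Eh : rev (enc (init_heap w)) =
      [:: false, false, false & rev (enc (heap1 ++ letters (size heap1) w))].
    by rewrite /init_heap -cats1 enc_cat rev_cat_catrev.
  rewrite /conf size_init_heap Eh.
  have := @exec_push 3 true (cfg [::] [:: false, false, false &
    rev (enc (heap1 ++ letters (size heap1) w))] [::] [::] [::]
    [:: pt; 0; q; 0; 0; 0; 0; (size heap1 + size w).+1; 0]) 2 isT.
  by rewrite upd_cfg3; apply.
by rewrite /=; lia.
Qed.

End Machine.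

(** * The polynomial time bound *)

Definition whole (heap1 : seq node) (pt q : nat) : prog :=
  Seq (init_prog heap1 pt q) (Seq main (pour 4 14)).

Lemma bounded_push_bits s : bounded_by 14 (push_bits s).
Proof. by elim: s. Qed.

Lemma bounded_push_ones i n : i <= 14 -> bounded_by 14 (push_ones i n).
Proof. by move=> i14; elim: n => //= n ->; rewrite i14. Qed.

Lemma bounded_whole heap1 pt q : bounded_by 14 (whole heap1 pt q).
Proof. by rewrite /= !bounded_push_bits !bounded_push_ones. Qed.

Lemma base_good : good base. Proof. by []. Qed.

Lemma rep_letter heap b : rep_code (base ++ heap) (letter_code b) (letter b).
Proof.
apply: rep_code_cat; have v0 : rep_code base 0 (Var 0) by apply: (@rep_code_var0 _ _ 0 0).
have v1 : rep_code base 1 (Var 1) by apply: rep_code_varS v0.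
by case: b => //; apply: rep_code_varS v1.
Qed.

Lemma rep_init tn pt t w k (q := size (base ++ tn))
    (heap := init_heap ((base ++ tn) ++ church_heap q) w) :
  good (base ++ tn) -> rep_code (base ++ tn) pt t -> pt < q ->
  [/\ rep_clo heap pt 0 (Clo t [::]),
      rep_clos heap q (Clo (church w) [::] :: consts k) &
      small heap pt 0 q].
Proof.
move=> G Ht lt; set h1 := (base ++ tn) ++ church_heap q in heap *.
have sz1 : size h1 = q.+4 by rewrite /h1 size_cat addn4.
have G1 : good h1.
  have -> : h1 = rcons (rcons (rcons (rcons (base ++ tn) (q.+1, 0, 8)) (2, q.+2, 0))
                          (2, q.+3, 0)) (2, q.+4, 0).
    by rewrite -!cats1 -!catA.
  do 4 (apply: good_rcons; last by rewrite ?size_rcons -/q /node_le /=; lia).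
  exact: G.
have G2 : good heap.
  apply: good_rcons; first exact: good_letters.
  by rewrite /node_le.
have at_h i x : node_at (church_heap q) i x -> node_at heap (q + i) x.
  case=> lti nx; rewrite /heap /init_heap -cats1 -catA; apply: node_at_cat.
  by split; rewrite ?size_cat ?ltn_add2l // nth_cat ltnNge leq_addr addKn.
have hE : exists h', heap = base ++ h'.
  by rewrite /heap /init_heap /h1 -cats1 -!catA; eexists.
have hE' : exists h', heap = (base ++ tn) ++ h'.
  by rewrite /heap /init_heap /h1 -cats1 -(catA (base ++ tn)) -(catA (base ++ tn)); eexists.
split.
- by apply: rep_clo_clo (rep_clos_nil _ _); have [h' ->] := hE'; apply: rep_code_cat.
- apply: (@rep_clos_cons _ _ q.+1 0 8).
  + by have := at_h 0 (q.+1, 0, 8); rewrite addn0; apply.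
  + apply: rep_clo_clo (rep_clos_nil _ _).
    apply: (@rep_code_lam _ _ _ q.+2 0); first by have := at_h 1 (2, q.+2, 0); rewrite addn1; apply.
    apply: (@rep_code_lam _ _ _ q.+3 0); first by have := at_h 2 (2, q.+3, 0); rewrite addn2; apply.
    apply: (@rep_code_lam _ _ _ q.+4 0); first by have := at_h 3 (2, q.+4, 0); rewrite addn3; apply.
    rewrite -sz1; apply: rep_letters => b; rewrite /h1 -catA; exact: rep_letter.
  + by have [h' ->] := hE; apply: rep_consts.
- have szh : size heap = (size h1 + size w).+1 by exact: size_init_heap.
  by case: G2 => _ H; rewrite /small H szh sz1 /=; lia.
Qed.

Theorem polytime_reads t (f : word -> word) (P : npoly) :
  (forall w, reads (Clo t [::], [:: Clo (church w) [::]]) (ev (size w) P) (f w)) ->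
  polytime f.
Proof.
move=> Hf; have [tn [pt [G lt Ht]]] := rep_code_exists t base_good.
set q := size (base ++ tn) in lt; pose h1 := (base ++ tn) ++ church_heap q.
pose c0 := 2 * size (enc h1) + 2 * size h1 + 2 * pt + 2 * q + 30.
(* The initial memory has [size h1 + size w + 1] nodes and each transition adds at most one; the
   remaining 7 comes from [bound]. *)
pose Z : npoly := ((size h1 + 8)%:P + 'X + P)%R.
(* The factor [2 * P + 1] bounds the rounds of the loop, and [5 * P] the final pour, since the
   output has length at most [P]. *)
pose Q : npoly := (c0%:P + 'X * (12%:P * ((size h1)%:P + 'X) + 40%:P) +
  (2%:P * P + 1%:P) * (2000%:P * (Z * Z) + 1%:P) + 5%:P * P)%R.
apply: (@polytime_prog f 14 (whole h1 pt q) Q) => [|w]; first exact: bounded_whole.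
have e1 := exec_init h1 pt q w.
have [Hc Hs sm] : [/\ rep_clo (init_heap h1 w) pt 0 (Clo t [::]),
    forall k, rep_clos (init_heap h1 w) q (Clo (church w) [::] :: consts k) &
    small (init_heap h1 w) pt 0 q].
  have H k := rep_init w k G Ht lt.
  by split=> [|k|]; [case: (H 0) | case: (H k) | case: (H 0)].
have [h' hE] : exists h', init_heap h1 w = base ++ h'.
  by rewrite /init_heap /h1 -cats1 -!catA; eexists.
have szh : size (init_heap h1 w) = (size h1 + size w).+1 by exact: size_init_heap.
rewrite hE in e1 Hc Hs sm szh.
have [|m e2 [m4 m14]] :=
  exec_reads (z := size (base ++ h') + ev (size w) P) [::] (Hf w) Hc Hs sm.
  by [].
have e3 := @exec_pour 4 14 m isT.
eexists; first apply: exec_le.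
- exact: exec_then e1 (exec_then e2 e3).
- rewrite m4 catrevE cats0 size_rev szh /Q /Z !evE.
  move: (reads_size (Hf w)); set n := size w; set K := ev n P; set m2 := size (f w) => le.
  have -> : bound ((size h1 + n).+1 + K) =
      2000 * ((size h1 + 8 + n + K) * (size h1 + 8 + n + K)).
    by rewrite /bound expnS expn1; congr (_ * (_ * _)); lia.
  set B := 2000 * _.
  have leB : (K + m2.+1) * B.+1 <= (2 * K + 1) * (B + 1).
    by rewrite addn1; apply: leq_mul => //; lia.
  move: leB; rewrite /c0; move: ((K + _) * _) ((2 * K + 1) * _) => X Y leB.
  move: (n * _) => V; lia.
- by rewrite upd_eq m4 m14 !catrevE !cats0 revK.
Qed.

Theorem theorem3 (t : term)
  (ht : dial [::] [::] t (Arr WChurch WScott)) :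
  exists f : word -> word,
    (forall w1 w2 : word,
        f w1 = w2 <-> beta_normal_form (App t (church w1)) (scott w2)) /\
    polytime f.
Proof.
have [P HP] := church_scott_reads ht.
have {}HP w : exists w2, reads (Clo t [::], [:: Clo (church w) [::]]) (ev (size w) P) w2 /\
    reds (App t (church w)) (scott w2) by have [w2] := HP w; exists w2.
(* The word is chosen for every input; uniqueness of normal forms and injectivity of [scott]
   identify it with the function of the statement. *)
pose f w := proj1_sig (constructive_indefinite_description _ (HP w)).
have Hf w := proj2_sig (constructive_indefinite_description _ (HP w)).
have nf w : beta_normal_form (App t (church w)) (scott (f w)).
  by split; [apply: (Hf w).2 | apply: scott_normal].
exists f; split=> [w1 w2|].
  by split=> [<- //|H]; apply/scott_inj/(beta_normal_form_unique (nf w1) H).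
by apply: (polytime_reads (P := P)) => w; apply: (Hf w).1.
Qed.
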